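(* There is a numerical constant $K>0$ such that the following holds. Let $n\ge 1$, let $\Psi\in\mathbb{R}^{n\times n}$ be an orthonormal basis (orthogonal matrix), let $h=(h_1,\dots,h_n)$ have independent entries with $\Pr(h_i=1)=\Pr(h_i=-1)=\tfrac12$, let $H$ be the $n\times n$ circulant convolution matrix generated by $h$, and let $U=H\Psi$. Fix a set $T\subset\{1,\dots,n\}$ with $|T|=S\ge 1$, and choose a sign sequence $z\in\{-1,+1\}^T$ uniformly at random, independently of $h$. Fix a set of sample locations $\Omega\subset\{1,\dots,n\}$ with $|\Omega|=m$, and let $\delta\in(0,1)$. Suppose that $$m > K\,S\,\mu^2(F,\Psi)\,\log(n/\delta)^{3/2}\cdot\max\left(\log\left(4e^2(S+1)^2\right),\ \log(n/\delta)\right).$$ Then with probability exceeding $1-\delta$ (over $h$ and $z$), every $x_0\in\mathbb{R}^n$ supported on $T$ with signs matching $z$ (i.e. $x_0(t)=0$ for $t\notin T$ and $\operatorname{sgn}(x_0(t))=z(t)$ for $t\in T$) is recovered from $y=U^\Omega x_0$ by $\ell_1$-minimization, that is, $x_0$ is the unique solution of $$\min_{\alpha\in\mathbb{R}^n}\|\alpha\|_{\ell_1}\quad\text{subject to}\quad U^\Omega\alpha=y .$$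
   Context: The circulant convolution matrix $H$ generated by $h=(h_1,\dots,h_n)$ has $k$-th row $h^{T}D^{k-1}$, where $D$ is the $n\times n$ cyclic shift matrix with $D_{i,i+1}=1$ for $1\le i\le n-1$, $D_{n,1}=1$, and all other entries $0$. So the first row is $(h_1,h_2,\dots,h_n)$, the second is $(h_n,h_1,\dots,h_{n-1})$, and so on. For a matrix $A$ with $n$ rows and $\Omega\subset\{1,\dots,n\}$, $A^\Omega$ is the submatrix of $A$ retaining only the rows indexed by $\Omega$; thus $U^\Omega=H^\Omega\Psi$. The vector $x_0$ is the coefficient vector in the basis $\Psi$ of the sensed signal $\Psi x_0$. The discrete Fourier matrix $F\in\mathbb{C}^{n\times n}$ has $(j,k)$ entry $e^{-2\pi i (j-1)(k-1)/n}$ (unnormalized), and the mutual coherence is $\mu(F,\Psi)=\max_{1\le i,j\le n}|(F\Psi)_{i,j}|$. Logarithms are natural. *)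

(* Defs.v *)
From HB Require Import structures.
From mathcomp Require Import all_boot all_order all_algebra.
From mathcomp Require Import all_classical all_reals all_analysis.
From mathcomp Require Export complex.

Set Implicit Arguments.
Unset Strict Implicit.
Unset Printing Implicit Defensive.

Import Order.TTheory GRing.Theory Num.Theory.
Import numFieldNormedType.Exports.

Local Open Scope classical_set_scope.
Local Open Scope ring_scope.

(* [ordS] is the successor modulo [n], so the last row has its 1 in column 0. *)
Definition shift_mx (R : realType) (n : nat) : 'M[R]_n :=
  \matrix_(i < n, j < n) (j == ordS i)%:R.

Definition circulant_mx (R : realType) (n : nat) (h : 'rV[R]_n) : 'M[R]_n :=
  \matrix_(k < n) (h *m (shift_mx R n ^+ k)).

Definition submx_rows (R : realType) (m n : nat) (Omega : {set 'I_m})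
    (A : 'M[R]_(m, n)) : 'M[R]_(#|Omega|, n) :=
  rowsub (fun i : 'I_#|Omega| => enum_val i) A.

Definition expi (R : realType) (t : R) : R[i] := Complex (cos t) (sin t).

(* Indices start at 0 here, which absorbs the "- 1" of the 1-based formula. *)
Definition dft_mx (R : realType) (n : nat) : 'M[R[i]]_n :=
  \matrix_(j < n, k < n) expi (- (2 * pi * j%:R * k%:R / n%:R)).

(* The default value 0 of the iterated maximum is harmless: moduli are
   nonnegative. *)
Definition coherence (R : realType) (n : nat) (F : 'M[R[i]]_n) (Psi : 'M[R]_n)
    : R :=
  \big[Num.max/0]_(i < n) \big[Num.max/0]_(j < n)
    Normc.normc ((F *m map_mx (real_complex R) Psi) i j).

Definition orthogonal_mx (R : realType) (n : nat) (Psi : 'M[R]_n) : Prop :=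
  Psi^T *m Psi = 1%:M.

Definition l1norm (R : realType) (n : nat) (a : 'cV[R]_n) : R :=
  \sum_(i < n) `|a i 0|.

Definition l1_minimizer (R : realType) (m n : nat) (A : 'M[R]_(m, n))
    (y : 'cV[R]_m) (a : 'cV[R]_n) : Prop :=
  A *m a = y /\ forall b : 'cV[R]_n, A *m b = y -> l1norm a <= l1norm b.

Definition unique_l1_minimizer (R : realType) (m n : nat) (A : 'M[R]_(m, n))
    (y : 'cV[R]_m) (a : 'cV[R]_n) : Prop :=
  l1_minimizer A y a /\ forall b : 'cV[R]_n, l1_minimizer A y b -> b = a.

Definition supported_with_signs (R : realType) (n : nat) (T : {set 'I_n})
    (z : {t : 'I_n | t \in T} -> R) (x : 'cV[R]_n) : Prop :=
  (forall t : 'I_n, t \notin T -> x t 0 = 0) /\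
  (forall t : {t : 'I_n | t \in T}, Num.sg (x (val t) 0) = z t).

Section probability_notions.
Context (R : realType) (d : measure_display) (W : measurableType d).
Context (P : probability W R).

Definition rademacher (X : {RV P >-> R}) : Prop :=
  P (X @^-1` [set 1]) = (1 / 2)%:E /\ P (X @^-1` [set -1]) = (1 / 2)%:E.

Definition independent_family (I : finType) (X : I -> {RV P >-> R}) : Prop :=
  forall (J : {set I}) (B : I -> set R), (forall i, measurable (B i)) ->
    P (\bigcap_(i in [set i | i \in J]) (X i @^-1` B i)) =
    (\prod_(i in J) P (X i @^-1` B i))%E.

Definition uniform_signs (I : finType) (X : I -> {RV P >-> R}) : Prop :=
  forall s : I -> bool,
    P (\bigcap_(i in [set: I]) (X i @^-1` [set (-1) ^+ s i])) =
    ((2 ^+ #|I|)^-1)%:E.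

Definition sigma_generated (I : Type) (X : I -> {RV P >-> R}) : set (set W) :=
  <<s [set A | exists i : I, exists2 B : set R,
        measurable B & A = X i @^-1` B] >>.

Definition independent_of (I J : Type) (X : I -> {RV P >-> R})
    (Y : J -> {RV P >-> R}) : Prop :=
  forall A B : set W, sigma_generated X A -> sigma_generated Y B ->
    P (A `&` B) = (P A * P B)%E.

End probability_notions.

(* Main.v *)
Require Import Defs.
From HB Require Import structures.
From mathcomp Require Import all_boot all_order all_algebra.
From mathcomp Require Import all_classical all_reals all_analysis.
From mathcomp Require Import complex.
From mathcomp Require Import ring lra zify.
Set Implicit Arguments.
Unset Strict Implicit.
Unset Printing Implicit Defensive.
Import Order.TTheory GRing.Theory Num.Theory.
Import numFieldNormedType.Exports.
Local Open Scope classical_set_scope.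
Local Open Scope ring_scope.

(** Write a_t for column t of the sampled matrix, A for the matrix of the
    columns in T, m for the number of samples, S for the size of T and mu for
    the coherence.

    Duality reduces recovery to a statement about A.  A vector x0 with support
    T and signs z is the unique l1 minimizer as soon as A is injective and some
    w satisfies <a_t, w> = z_t on T and |<a_t, w>| < 1 off T
    (l1_certificate).  The least squares candidate w = A (A^T A)^-1 z takes the
    value <v_t, z> at t outside T, where v_t = (A^T A)^-1 A^T a_t
    (l1_recovery).  Three facts suffice: the error A^T A - m has norm at most
    m/2; the correlations <a_s, a_t> are so small that |v_t| is small; and,
    z being independent of v_t, the sign sums <v_t, z> stay below 1.

    Each fact follows from a moment of order 2p, with p just above
    L = log(n/delta), and all the moments come from one mechanism
    (sign_moment).  Let Z be a symmetric matrix depending on the signs e_i,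
    with Z = kappa sum_i e_i D_i, where flipping e_i changes Z by 2 e_i D_i
    and leaves D_i alone.  Pairing each sign pattern with its flip turns
    E tr Z^2p into a sum of terms tr(D_i X^k D_i Y^l), which a trace form of
    the Heinz inequality (trace_heinz) bounds by tr(D_i^2 Z^(2p-2)).  If
    sum_i D_i^2 <= nu, then Young's inequality for traces absorbs the power of
    Z and gives E tr Z^2p <= dim * E (4 p nu)^p.  For linear Z this is
    Khintchine's inequality.  For the quadratic Z = A^T A - E A^T A the number
    nu depends on Z through |A|^2 <= m + |Z|, and this feedback can be
    absorbed as well (chaos_moment).

    The convolution structure enters through one identity: correlation becomes
    multiplication after a discrete Fourier transform (dft_sq_hankel).  So the
    correlation operator of column t of Psi has norm at most mu, which bounds
    the linear terms of nu.  The remaining term, sum_i |A^T V_i x|^2 with V_i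
    the coefficient of e_i in A, is a sum over t in T of the energy of the
    correlation of Psi x with a_t; it is bounded by the largest Fourier
    coefficient of a_t, which is a scalar sign sum of variance at most mu^2 m
    (slice_cross_bound, dft_moment).

    All three bounds need only that p^2 S mu^2 / m is below a constant, and
    each bad event then has probability at most a polynomial in n times eta^p
    with eta = e^-8.  As e^-p < delta/n, the total is at most
    14 n^3 (delta/n)^8 < delta for n >= 2 (failure_small).  Since L >= 1/2, the
    hypothesis gives m > K S mu^2 L^2 / 2, which is of the required order
    (level_bound).  In dimension 1 recovery always succeeds (recovery_dim1).
    The random variables matter only through their sign pattern, whose law is
    uniform, so every probability is a count of patterns (sign_event_prob). *)

(** * Frobenius norms and traces of powers of symmetric matrices *)

Definition fsq (R : realFieldType) (a b : nat) (M : 'M[R]_(a, b)) : R :=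
  \tr (M^T *m M).

Section Frobenius.
Variable R : realFieldType.

Lemma fsqE (a b : nat) (M : 'M[R]_(a, b)) :
  fsq M = \sum_i \sum_j M i j ^+ 2.
Proof.
rewrite /fsq /mxtrace exchange_big; apply: eq_bigr => j _.
by rewrite !mxE; apply: eq_bigr => i _; rewrite !mxE expr2.
Qed.

Lemma fsq_cV (a : nat) (x : 'cV[R]_a) : fsq x = \sum_i x i 0 ^+ 2.
Proof. by rewrite fsqE; apply: eq_bigr => i _; rewrite big_ord1. Qed.

Lemma fsq_ge0 (a b : nat) (M : 'M[R]_(a, b)) : 0 <= fsq M.
Proof. by rewrite fsqE; do 2![apply: sumr_ge0 => ? _]; apply: sqr_ge0. Qed.

Lemma fsq_eq0 (a b : nat) (M : 'M[R]_(a, b)) : fsq M = 0 -> M = 0.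
Proof.
rewrite fsqE => /eqP; rewrite psumr_eq0; last first.
  by move=> i _; apply: sumr_ge0 => ? _; apply: sqr_ge0.
move=> /allP H; apply/matrixP => i j; rewrite mxE.
have := H i (mem_index_enum _); rewrite psumr_eq0 => [|k _]; last exact: sqr_ge0.
by move=> /allP /(_ j (mem_index_enum _)); rewrite sqrf_eq0 => /eqP.
Qed.

Lemma fsq_tr (a b : nat) (M : 'M[R]_(a, b)) : fsq M^T = fsq M.
Proof. by rewrite /fsq trmxK mxtrace_mulC. Qed.

Lemma trace_dotC (a b : nat) (A B : 'M[R]_(a, b)) :
  \tr (A^T *m B) = \tr (B^T *m A).
Proof. by rewrite -mxtrace_tr trmx_mul trmxK. Qed.

Lemma fsqD (a b : nat) (A B : 'M[R]_(a, b)) :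
  fsq (A + B) = fsq A + 2 * \tr (A^T *m B) + fsq B.
Proof.
rewrite /fsq [(A + B)^T]linearD /= mulmxDl !mulmxDr !mxtraceD (trace_dotC B A).
by ring.
Qed.

Lemma trace_dotZ (a b : nat) (s t : R) (A B : 'M[R]_(a, b)) :
  \tr ((s *: A)^T *m (t *: B)) = s * t * \tr (A^T *m B).
Proof.
by rewrite [(s *: A)^T]linearZ /= -scalemxAl -scalemxAr !mxtraceZ mulrA.
Qed.

Lemma fsqZ (a b : nat) (k : R) (A : 'M[R]_(a, b)) : fsq (k *: A) = k ^+ 2 * fsq A.
Proof. by rewrite /fsq trace_dotZ expr2. Qed.

Lemma fsqN (a b : nat) (A : 'M[R]_(a, b)) : fsq (- A) = fsq A.
Proof. by rewrite -scaleN1r fsqZ sqrrN expr1n mul1r. Qed.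

Lemma fsq_colsum (a b : nat) (A : 'M[R]_(a, b)) : fsq A = \sum_j fsq (col j A).
Proof.
rewrite fsqE exchange_big; apply: eq_bigr => j _; rewrite fsq_cV.
by apply: eq_bigr => i _; rewrite mxE.
Qed.

Lemma trace_dot_le (a b : nat) (A B : 'M[R]_(a, b)) :
  2 * \tr (A^T *m B) <= fsq A + fsq B.
Proof.
have := fsq_ge0 (A - B); rewrite fsqD fsqN mulmxN raddfN /=; lra.
Qed.

Lemma cauchy_schwarz_sum (I : finType) (f g : I -> R) :
  (\sum_i f i * g i) ^+ 2 <= (\sum_i f i ^+ 2) * (\sum_i g i ^+ 2).
Proof.
set F := \sum_i f i ^+ 2; set G := \sum_i g i ^+ 2; set X := \sum_i f i * g i.
have quad (s t : R) : 0 <= s ^+ 2 * F - 2 * s * t * X + t ^+ 2 * G.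
  have -> : s ^+ 2 * F - 2 * s * t * X + t ^+ 2 * G =
            \sum_i (s * f i - t * g i) ^+ 2.
    rewrite /F /G /X !mulr_sumr -sumrB -big_split /=.
    by apply: eq_bigr => i _; ring.
  by apply: sumr_ge0 => i _; apply: sqr_ge0.
have F0 : 0 <= F by apply: sumr_ge0 => i _; apply: sqr_ge0.
have := F0; rewrite le_eqVlt => /predU1P [Fz|Fpos].
  have Xz : X = 0.
    rewrite /X big1 // => i _.
    have : f i ^+ 2 = 0.
      apply/eqP; rewrite eq_le sqr_ge0 andbT [X in _ <= X]Fz /F (bigD1 i) //=.
      by rewrite lerDl; apply: sumr_ge0 => ? _; apply: sqr_ge0.
    by move=> /eqP; rewrite sqrf_eq0 => /eqP ->; rewrite mul0r.
  by rewrite Xz -Fz expr0n mul0r.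
have := quad X F; have -> : X ^+ 2 * F - 2 * X * F * X + F ^+ 2 * G =
   F * (F * G - X ^+ 2) by ring.
by rewrite pmulr_rge0 // subr_ge0.
Qed.

Lemma fsq_mulmx_le (a b c : nat) (A : 'M[R]_(a, b)) (B : 'M[R]_(b, c)) :
  fsq (A *m B) <= fsq A * fsq B.
Proof.
rewrite [fsq (A *m B)]fsqE [fsq A]fsqE mulr_suml; apply: ler_sum => i _.
rewrite -[fsq B]fsq_tr [fsq _]fsqE mulr_sumr; apply: ler_sum => j _.
rewrite mxE; apply: le_trans (cauchy_schwarz_sum _ _) _.
by rewrite le_eqVlt; apply/orP; left; apply/eqP; congr (_ * _); apply: eq_bigr => k _; rewrite mxE.
Qed.

Lemma trmx_exp (a k : nat) (X : 'M[R]_a) : X^T = X -> (X ^+ k)^T = X ^+ k.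
Proof.
move=> sX; elim: k => [|k IH]; first by rewrite expr0 trmx1.
by rewrite [in LHS]exprS -mulmxE trmx_mul IH sX mulmxE -exprSr.
Qed.

Lemma trace_exp_even (a k : nat) (X : 'M[R]_a) :
  X^T = X -> \tr (X ^+ (2 * k)) = fsq (X ^+ k).
Proof. by move=> sX; rewrite /fsq trmx_exp // mul2n -addnn exprD. Qed.

(** The form of the maximum principle that trace_heinz uses; the sum replaces the
    maximum of the end values. *)
Lemma convex_seq_le_ends (q : nat) (g : nat -> R) :
  (forall a, (a <= q)%N -> 0 <= g a) ->
  (forall a, (0 < a < q)%N -> 2 * g a <= g a.-1 + g a.+1) ->
  forall a, (a <= q)%N -> g a <= g 0 + g q.
Proof.
elim: q g => [|q IH] g g0 cv a.
  by rewrite leqn0 => /eqP ->; have := g0 0%N isT; lra.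
rewrite leq_eqVlt => /predU1P [->|]; first by have := g0 0%N isT; lra.
rewrite ltnS => aq.
have [gq|gq] := lerP (g q) (g q.+1).
  have /(_ a aq) : forall b, (b <= q)%N -> g b <= g 0 + g q; last lra.
  apply: IH => [b bq|b /andP [b0 bq]]; first exact/g0/leqW.
  by apply: cv; rewrite b0 ltnW.
(* The last step is a descent, so by convexity the whole sequence descends. *)
have dec k : (k <= q)%N -> g (q - k).+1 <= g (q - k)%N.
  elim: k => [|k IHk] kq; first by rewrite subn0 ltW.
  have := IHk (ltnW kq); have := cv (q - k)%N.
  have -> : (q - k = (q - k.+1).+1)%N by lia.
  have hk : (0 < (q - k.+1).+1 < q.+1)%N by lia.
  by move=> /(_ hk) /=; lra.
have : g a <= g 0%N.
  elim: a aq => [|a IHa] aq //; apply: le_trans (IHa (ltnW aq)).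
  have := dec (q - a)%N; rewrite subKn; last by lia.
  by apply; lia.
by have := g0 q.+1 (leqnn _); lra.
Qed.

(** After moving half of each even power across the trace, tr(D X^k D Y^l) is a
    Frobenius inner product; this makes i |-> |X^i D Y^(q-i)|^2 convex, so it is
    largest at an end. *)
Lemma trace_heinz (a q k l : nat) (D X Y : 'M[R]_a) :
  D^T = D -> X^T = X -> Y^T = Y -> (k + l = 2 * q)%N ->
  \tr (D * X ^+ k * D * Y ^+ l) <= fsq (X ^+ q * D) + fsq (Y ^+ q * D).
Proof.
move=> sD sX sY kl.
pose g i := fsq (X ^+ i * D * Y ^+ (q - i)).
have dot i j : (i <= q)%N -> (j <= q)%N ->
    2 * \tr (D * X ^+ (i + j) * D * Y ^+ (2 * q - (i + j))) <= g i + g j.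
  move=> iq jq; apply: le_trans (trace_dot_le _ _).
  rewrite -!mulmxE !trmx_mul !trmx_exp // sD exprD.
  have -> : (2 * q - (i + j) = (q - j) + (q - i))%N by lia.
  rewrite exprD -!mulmxE !mulmxA [X in _ <= 2 * X]mxtrace_mulC.
  rewrite -!mulmxA [X in _ <= 2 * X]mxtrace_mulC -!mulmxA.
  by rewrite [X in _ <= 2 * X]mxtrace_mulC -!mulmxA.
have gle i : (i <= q)%N -> g i <= g 0 + g q.
  apply: convex_seq_le_ends => {}i; first by rewrite fsq_ge0.
  move=> /andP [i0 iq].
  suff -> : g i = \tr (D * X ^+ (i.-1 + i.+1) * D * Y ^+ (2 * q - (i.-1 + i.+1))).
    by apply: dot; lia.
  have -> : (i.-1 + i.+1 = i + i)%N by lia.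
  have -> : (2 * q - (i + i) = (q - i) + (q - i))%N by lia.
  rewrite /g /fsq -!mulmxE !trmx_mul !trmx_exp // sD !exprD -!mulmxE.
  by rewrite -!mulmxA [LHS]mxtrace_mulC -!mulmxA.
have [i [j [iq jq ij]]] : exists i j, [/\ (i <= q)%N, (j <= q)%N & (i + j = k)%N].
  by exists (k - k./2)%N, k./2; split; lia.
have -> : (l = 2 * q - (i + j))%N by lia.
rewrite -ij; have := dot i j iq jq; have := gle i iq; have := gle j jq.
rewrite /g !expr0 subn0 subnn mul1r expr0 mulr1.
rewrite -[fsq (D * _)]fsq_tr -mulmxE trmx_mul trmx_exp // sD; lra.
Qed.

(** Young's inequality p x y^(p-1) <= x^p + (p-1) y^p summed over the eigenvalues y
    of Z^2.  The induction step adds tr((x - Z^2)^2 Z^(2p)) >= 0. *)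
Lemma trace_young (a p : nat) (x : R) (Z : 'M[R]_a) : 0 <= x -> Z^T = Z ->
  p.+1%:R * x * \tr (Z ^+ (2 * p)) <=
  a%:R * x ^+ p.+1 + p%:R * \tr (Z ^+ (2 * p.+1)).
Proof.
move=> x0 sZ; elim: p => [|p IH].
  by rewrite muln0 expr0 mxtrace1 mul0r addr0 mul1r expr1 mulrC.
have sq : 0 <= x ^+ 2 * \tr (Z ^+ (2 * p)) - 2 * x * \tr (Z ^+ (2 * p.+1))
             + \tr (Z ^+ (2 * p.+2)).
  have := fsq_ge0 (x *: Z ^+ p - Z ^+ p.+2).
  rewrite -[X in _ - X]scale1r fsqD fsqN !fsqZ mulmxN raddfN /= trace_dotZ.
  rewrite !trace_exp_even // trmx_exp // mulmxE -exprD.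
  rewrite (_ : p + p.+2 = 2 * p.+1)%N ?trace_exp_even //; last lia.
  by rewrite -!trace_exp_even //; lra.
have {}IH := ler_wpM2l x0 IH.
have {}sq : 0 <= p.+1%:R * (x ^+ 2 * \tr (Z ^+ (2 * p)) - 2 * x * \tr (Z ^+ (2 * p.+1))
             + \tr (Z ^+ (2 * p.+2))) by apply: mulr_ge0.
move: IH sq; rewrite -!natr1 [x ^+ p.+2]exprS.
set t0 := \tr _; set t1 := \tr _; set t2 := \tr _; set y := x ^+ p.+1.
move=> IH sq; nra.
Qed.

(** An even trace power bounds the operator norm.  The numbers |Z^k x|^2 are
    log-convex in k, so their successive ratios do not decrease. *)
Lemma fsq_mul_exp_le (a p : nat) (Z : 'M[R]_a) (x : 'cV[R]_a) : Z^T = Z ->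
  fsq (Z *m x) ^+ p.+1 <= \tr (Z ^+ (2 * p.+1)) * fsq x ^+ p.+1.
Proof.
move=> sZ; pose u k := fsq (Z ^+ k *m x).
have u0 k : 0 <= u k by exact: fsq_ge0.
have dotE i j : (Z ^+ i *m x)^T *m (Z ^+ j *m x) = x^T *m (Z ^+ (i + j) *m x).
  by rewrite trmx_mul trmx_exp // exprD -mulmxE -!mulmxA.
have uconv (s t : R) k : 0 <= s ^+ 2 * u k - 2 * s * t * u k.+1 + t ^+ 2 * u k.+2.
  have := fsq_ge0 (s *: (Z ^+ k *m x) - t *: (Z ^+ k.+2 *m x)).
  rewrite fsqD fsqN !fsqZ mulmxN raddfN /= trace_dotZ.
  suff -> : \tr ((Z ^+ k *m x)^T *m (Z ^+ k.+2 *m x)) = u k.+1 by rewrite /u; lra.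
  by rewrite /u /fsq !dotE addSnnS.
have grow k : 0 < u 0%N -> u 1%N * u k <= u 0%N * u k.+1.
  move=> upos; elim: k => [|k IHk]; first by rewrite mulrC.
  rewrite -(ler_pM2l upos); have := uconv (u 1%N) (u 0%N) k.
  have := ler_wpM2l (u0 1%N) IHk; lra.
have pw k : u 1%N ^+ k.+1 <= u k.+1 * u 0%N ^+ k.
  elim: k => [|k IHk]; first by rewrite expr0 expr1 mulr1.
  have := u0 0%N; rewrite le_eqVlt => /predU1P [uz|upos].
    have xz : x = 0 by apply: fsq_eq0; move: uz; rewrite /u expr0 mul1mx.
    by rewrite /u xz !mulmx0 /fsq mulmx0 raddf0 exprS !mul0r.
  rewrite exprS; apply: le_trans (ler_wpM2l (u0 1%N) IHk) _.
  by rewrite mulrA exprS mulrA (mulrC (u k.+2)) ler_wpM2r ?grow // exprn_ge0.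
have := pw p; rewrite {1}/u expr1 => /le_trans; apply.
rewrite (_ : u 0%N = fsq x); last by rewrite /u expr0 mul1mx.
rewrite exprS mulrA ler_wpM2r ?exprn_ge0 ?fsq_ge0 //.
by rewrite trace_exp_even // fsq_mulmx_le.
Qed.

End Frobenius.

(** * Moments of functions of random signs *)

Definition sign_of (R : realFieldType) (I : finType) (e : {ffun I -> bool})
  (i : I) : R := (-1) ^+ e i.

Definition flip (I : finType) (i : I) (e : {ffun I -> bool}) : {ffun I -> bool} :=
  [ffun j => (j == i) (+) e j].

Section SignCube.
Variables (R : realFieldType) (I : finType).
Implicit Types (e : {ffun I -> bool}) (i : I).
Notation s_ := (@sign_of R I).

Lemma mxtrace_sum (J : Type) (r : seq J) (P : pred J) (a : nat) (F : J -> 'M[R]_a) :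
  \tr (\sum_(j <- r | P j) F j) = \sum_(j <- r | P j) \tr (F j).
Proof. exact: (raddf_sum (@mxtrace R a)). Qed.

Lemma mxtrace_mul_sumr (J : Type) (r : seq J) (P : pred J) (a : nat)
    (A : 'M[R]_a) (F : J -> 'M[R]_a) :
  \tr (A * \sum_(j <- r | P j) F j) = \sum_(j <- r | P j) \tr (A * F j).
Proof. by rewrite [X in \tr X]mulr_sumr mxtrace_sum. Qed.

Lemma mxtrace_mul_suml (J : Type) (r : seq J) (P : pred J) (a : nat)
    (A : 'M[R]_a) (F : J -> 'M[R]_a) :
  \tr ((\sum_(j <- r | P j) F j) * A) = \sum_(j <- r | P j) \tr (F j * A).
Proof. by rewrite [X in \tr X]mulr_suml mxtrace_sum. Qed.

Lemma sum_flip (f : {ffun I -> bool} -> R) i : \sum_e f (flip i e) = \sum_e f e.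
Proof.
have fK : involutive (flip i).
  by move=> e; apply/ffunP => j; rewrite !ffunE addKb.
by rewrite [RHS](reindex_inj (inv_inj fK)).
Qed.

Lemma sign_sq e i : s_ e i * s_ e i = 1.
Proof. by rewrite /sign_of -expr2 sqrr_sign. Qed.

Lemma sign_flip e i : s_ (flip i e) i = - s_ e i.
Proof. by rewrite /sign_of ffunE eqxx addTb signrN. Qed.

Lemma sign_flip_neq e i j : j != i -> s_ (flip i e) j = s_ e j.
Proof. by move=> /negbTE ji; rewrite /sign_of ffunE ji. Qed.

(** Telescoping, with the factors in an order that is valid for matrices. *)
Lemma subrXX_noncomm (A : pzRingType) (X Y : A) (r : nat) :
  X ^+ r.+1 - Y ^+ r.+1 = \sum_(k < r.+1) X ^+ k * (X - Y) * Y ^+ (r - k).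
Proof.
elim: r => [|r IH]; first by rewrite big_ord1 !expr0 mul1r mulr1 !expr1.
rewrite big_ord_recr /= subnn expr0 mulr1.
have -> : \sum_(k < r.+1) X ^+ k * (X - Y) * Y ^+ (r.+1 - k) =
          (X ^+ r.+1 - Y ^+ r.+1) * Y.
  rewrite IH mulr_suml; apply: eq_bigr => k _.
  by rewrite subSn ?exprSr ?mulrA // -ltnS.
by rewrite mulrBl mulrBr -!exprSr addrC addrA subrK.
Qed.

(** Since D_i ignores the sign i, pairing e with its flip replaces Z^(2p+1) in
    E e_i tr(D_i Z^(2p+1)) by half of its difference under the flip, which
    telescopes into terms with two factors D_i. *)
Lemma sign_moment (a p : nat) (Z : {ffun I -> bool} -> 'M[R]_a)
    (D : I -> {ffun I -> bool} -> 'M[R]_a) (kap : R) (nu : {ffun I -> bool} -> R) :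
  (forall e, (Z e)^T = Z e) -> (forall i e, (D i e)^T = D i e) ->
  (forall i e, D i (flip i e) = D i e) ->
  (forall i e, Z e - Z (flip i e) = (2 * s_ e i) *: D i e) ->
  0 <= kap <= 1 -> (forall e, Z e = kap *: \sum_i s_ e i *: D i e) ->
  (forall e, 0 <= nu e) ->
  (forall e (x : 'cV_a), \sum_i fsq (D i e *m x) <= nu e * fsq x) ->
  \sum_e \tr (Z e ^+ (2 * p.+1)) <=
  a%:R * \sum_e (4 * p.+1%:R * nu e) ^+ p.+1.
Proof.
move=> sZ sD Dflip Zflip /andP [k0 k1] ZE nu0 nuP.
have step i : \sum_e s_ e i * \tr (D i e * Z e ^+ (2 * p).+1) <=
              2 * (2 * p).+1%:R * \sum_e fsq (D i e * Z e ^+ p).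
  have sum_anti : \sum_e s_ e i * \tr (D i e * Z e ^+ (2 * p).+1) =
      2^-1 * \sum_e s_ e i * \tr (D i e * (Z e ^+ (2 * p).+1 - Z (flip i e) ^+ (2 * p).+1)).
    under [in RHS]eq_bigr do rewrite mulrBr raddfB /= mulrBr.
    rewrite sumrB.
    rewrite -[X in _ - X](sum_flip _ i) /=.
    under [X in _ - X]eq_bigr => e _.
      rewrite sign_flip Dflip (_ : flip i (flip i e) = e); last first.
        by apply/ffunP => j; rewrite !ffunE addKb.
      rewrite mulNr; over.
    by rewrite /= sumrN opprK; field.
  rewrite sum_anti.
  have bound e : s_ e i * \tr (D i e * (Z e ^+ (2 * p).+1 - Z (flip i e) ^+ (2 * p).+1))
      <= 2 * (2 * p).+1%:R * (fsq (D i e * Z e ^+ p) + fsq (D i e * Z (flip i e) ^+ p)).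
    rewrite subrXX_noncomm mxtrace_mul_sumr mulr_sumr.
    set B := fsq _ + _.
    have -> : 2 * (2 * p).+1%:R * B = \sum_(k < (2 * p).+1) 2 * B.
      by rewrite sumr_const card_ord -mulr_natr; ring.
    apply: ler_sum => k _.
    rewrite Zflip -!mulmxE -scalemxAr -scalemxAl -scalemxAr mxtraceZ !mulmxE.
    rewrite !mulrA mulrAC -[s_ e i * 2 * _]mulrA mulrAC mulrA sign_sq.
    rewrite mul1r ler_wpM2l // /B.
    have kp : (k <= 2 * p)%N by rewrite -ltnS.
    apply: le_trans (trace_heinz (sD i e) (sZ _) (sZ _) (subnKC kp)) _.
    rewrite -[fsq (Z e ^+ p * _)]fsq_tr -[fsq (Z (flip i e) ^+ p * _)]fsq_tr.
    by rewrite -!mulmxE !trmx_mul !trmx_exp // sD.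
  (* The second Heinz term is the first one at the flipped pattern. *)
  have unflip : \sum_e fsq (D i e * Z (flip i e) ^+ p) = \sum_e fsq (D i e * Z e ^+ p).
    by rewrite -[RHS](sum_flip _ i); under [RHS]eq_bigr do rewrite Dflip.
  have : \sum_e s_ e i * \tr (D i e * (Z e ^+ (2 * p).+1 - Z (flip i e) ^+ (2 * p).+1))
      <= \sum_e 2 * (2 * p).+1%:R * (fsq (D i e * Z e ^+ p) + fsq (D i e * Z (flip i e) ^+ p)).
    exact: ler_sum.
  rewrite -mulr_sumr big_split /= unflip; lra.
have main : \sum_e \tr (Z e ^+ (2 * p.+1)) <=
    \sum_e (4 * p.+1%:R * nu e) * \tr (Z e ^+ (2 * p)).
  have -> : \sum_e \tr (Z e ^+ (2 * p.+1)) =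
      kap * \sum_i \sum_e s_ e i * \tr (D i e * Z e ^+ (2 * p).+1).
    rewrite [in RHS]exchange_big mulr_sumr; apply: eq_bigr => e _ /=.
    rewrite mulnS add2n exprS {1}ZE -mulmxE -scalemxAl mxtraceZ mulmxE; congr (_ * _).
    rewrite mxtrace_mul_suml; apply: eq_bigr => i _ /=.
    by rewrite -mulmxE -scalemxAl mxtraceZ.
  have rhs0 i : 0 <= 2 * (2 * p).+1%:R * \sum_e fsq (D i e * Z e ^+ p).
    by rewrite !mulr_ge0 // sumr_ge0 // => e _; apply: fsq_ge0.
  apply: (@le_trans _ _ (kap * \sum_i 2 * (2 * p).+1%:R * \sum_e fsq (D i e * Z e ^+ p))).
    by rewrite ler_wpM2l // ler_sum.
  apply: le_trans (ler_piMl (sumr_ge0 _ (fun i _ => rhs0 i)) k1) _.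
  rewrite -mulr_sumr exchange_big mulr_sumr; apply: ler_sum => e _ /=.
  have -> : 4 * p.+1%:R * nu e * \tr (Z e ^+ (2 * p)) =
      4 * p.+1%:R * (nu e * fsq (Z e ^+ p)) by rewrite trace_exp_even // mulrA.
  have dle : \sum_i fsq (D i e * Z e ^+ p) <= nu e * fsq (Z e ^+ p).
    under eq_bigr do rewrite fsq_colsum.
    rewrite exchange_big [fsq (Z e ^+ p)]fsq_colsum mulr_sumr.
    apply: ler_sum => j _; under eq_bigr do rewrite colE -mulmxE -mulmxA -colE.
    exact: nuP.
  have sum_ge0 : 0 <= \sum_i fsq (D i e * Z e ^+ p).
    by apply: sumr_ge0 => i _; apply: fsq_ge0.
  have coef_ge0 : 0 <= 2 * (2 * p).+1%:R :> R by apply: mulr_ge0.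
  apply: (ler_pM coef_ge0 sum_ge0 _ dle).
  by rewrite -!natrM ler_nat; lia.
have young : \sum_e (4 * p.+1%:R * nu e) * \tr (Z e ^+ (2 * p)) * p.+1%:R <=
    \sum_e (a%:R * (4 * p.+1%:R * nu e) ^+ p.+1 + p%:R * \tr (Z e ^+ (2 * p.+1))).
  apply: ler_sum => e _; rewrite mulrC mulrA; apply: trace_young => //.
  by rewrite !mulr_ge0.
move: young; rewrite big_split /= -!mulr_sumr -mulr_suml.
have := ler_wpM2r (ler0n R p.+1) main.
rewrite -natr1; lra.
Qed.
End SignCube.

(** * Matrix-valued chaos of order two *)

Lemma exprn_add2_le (R : realFieldType) (p : nat) (x y : R) : 0 <= x -> 0 <= y ->
  (x + y) ^+ p <= (2 * x) ^+ p + (2 * y) ^+ p.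
Proof.
move=> x0 y0; wlog xy : x y x0 y0 / x <= y.
  move=> H; have [/H|/ltW /H] := lerP x y; first exact.
  by rewrite (addrC y) (addrC ((2 * y) ^+ p)); apply.
apply: (@le_trans _ _ ((2 * y) ^+ p)).
  by apply: lerXn2r; rewrite ?nnegrE ?addr_ge0 ?mulr_ge0 //; lra.
by rewrite lerDr exprn_ge0 // mulr_ge0.
Qed.

Lemma exprn_add3_le (R : realFieldType) (p : nat) (x y z : R) :
  0 <= x -> 0 <= y -> 0 <= z ->
  (x + y + z) ^+ p <= (3 * x) ^+ p + (3 * y) ^+ p + (3 * z) ^+ p.
Proof.
move=> x0 y0 z0.
have pos (t : R) : 0 <= t -> 0 <= (3 * t) ^+ p by move=> t0; rewrite exprn_ge0 ?mulr_ge0.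
have tx := pos x x0; have ty := pos y y0; have tz := pos z z0.
have mono t : 0 <= t -> x + y + z <= 3 * t -> (x + y + z) ^+ p <= (3 * t) ^+ p.
  by move=> t0 le; apply: lerXn2r; rewrite ?nnegrE ?addr_ge0 ?mulr_ge0.
case: (lerP x y) => xy; case: (lerP y z) => yz; case: (lerP x z) => xz.
all: try (have := mono x x0 ltac:(lra); lra).
all: try (have := mono y y0 ltac:(lra); lra).
all: have := mono z z0 ltac:(lra); lra.
Qed.

Lemma fsq_add3_le (R : realFieldType) (a b : nat) (A B C : 'M[R]_(a, b)) :
  fsq (A + B - C) <= 3 * (fsq A + fsq B + fsq C).
Proof.
have e : A + B - C = (A + B) + (-1) *: C by rewrite scaleN1r.
rewrite e fsqD fsqZ fsqD.
have -> : \tr ((A + B)^T *m (-1 *: C)) = - (\tr (A^T *m C) + \tr (B^T *m C)).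
  by rewrite [(A + B)^T]linearD /= mulmxDl -!scalemxAr mxtraceD !mxtraceZ; ring.
have := trace_dot_le A B.
have := fsq_ge0 (A + C); have := fsq_ge0 (B + C); rewrite !fsqD.
have := fsq_ge0 (A - B); rewrite fsqD fsqN mulmxN raddfN /=; lra.
Qed.

Section Chaos.
Variables (R : realFieldType) (I : finType) (a b : nat) (V : I -> 'M[R]_(a, b)).
Notation s_ := (@sign_of R I).

Definition sign_sum (e : {ffun I -> bool}) : 'M[R]_(a, b) := \sum_i s_ e i *: V i.

(** The centred Gram matrix of a matrix sign sum A: the diagonal terms of A^T A do
    not depend on the signs. *)
Definition gram_chaos (e : {ffun I -> bool}) : 'M[R]_b :=
  (sign_sum e)^T *m sign_sum e - \sum_i (V i)^T *m V i.

(** Half of the change of the chaos under a flip of sign i, up to that sign; the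
    last term removes the contribution of the sign i itself. *)
Definition chaos_slope (i : I) (e : {ffun I -> bool}) : 'M[R]_b :=
  (V i)^T *m sign_sum e + (sign_sum e)^T *m V i - (2 * s_ e i) *: ((V i)^T *m V i).

Lemma sign_sum_flip i e : sign_sum (flip i e) = sign_sum e - (2 * s_ e i) *: V i.
Proof.
rewrite /sign_sum [in LHS](bigD1 i) // [in RHS](bigD1 i) //= sign_flip.
rewrite (eq_bigr (fun j => s_ e j *: V j)); last first.
  by move=> j ji; rewrite sign_flip_neq.
by rewrite addrAC -scalerBl; congr (_ *: _ + _); ring.
Qed.

Lemma gram_chaos_sym e : (gram_chaos e)^T = gram_chaos e.
Proof.
rewrite /gram_chaos linearB /= trmx_mul trmxK; congr (_ - _).
rewrite linear_sum /=; apply: eq_bigr => i _.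
by rewrite trmx_mul trmxK.
Qed.

Lemma chaos_slope_sym i e : (chaos_slope i e)^T = chaos_slope i e.
Proof.
rewrite /chaos_slope linearB /= linearD /= linearZ /= !trmx_mul !trmxK.
by rewrite [X in X - _]addrC.
Qed.

Lemma tr_sign_sum_flip i e :
  (sign_sum (flip i e))^T = (sign_sum e)^T - (2 * s_ e i) *: (V i)^T.
Proof. by rewrite sign_sum_flip linearB /= linearZ. Qed.

Lemma chaos_slope_flip i e : chaos_slope i (flip i e) = chaos_slope i e.
Proof.
rewrite /chaos_slope tr_sign_sum_flip sign_sum_flip sign_flip.
rewrite mulmxBr mulmxBl -scalemxAl -scalemxAr mulrN scaleNr opprK.
set u := _ *: _; rewrite addrACA -!addrA; congr (_ + (_ + _)).
by rewrite addNr addr0.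
Qed.

Lemma gram_chaos_flip i e :
  gram_chaos e - gram_chaos (flip i e) = (2 * s_ e i) *: chaos_slope i e.
Proof.
rewrite /gram_chaos /chaos_slope tr_sign_sum_flip sign_sum_flip.
rewrite opprB addrA subrK !mulmxBl !mulmxBr -!scalemxAl -!scalemxAr.
rewrite !scalerBr !scalerDr !scalerA.
set A := sign_sum e; set c := 2 * s_ e i.
move: (A^T *m A) (A^T *m V i) ((V i)^T *m A) ((V i)^T *m V i) => P1 P2 P3 P4.
by apply/matrixP => k l; rewrite !mxE; ring.
Qed.

(** Euler's identity for a form that is homogeneous of degree two in the signs;
    hence the factor 1/2. *)
Lemma gram_chaosE e : gram_chaos e = 2^-1 *: \sum_i s_ e i *: chaos_slope i e.
Proof.
have -> : \sum_i s_ e i *: chaos_slope i e = 2 *: gram_chaos e; last first.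
  by rewrite scalerA mulVf ?scale1r // pnatr_eq0.
rewrite /gram_chaos scalerBr scaler_sumr.
under eq_bigr => i _.
  rewrite /chaos_slope scalerBr scalerDr scalerA mulrCA sign_sq mulr1.
  rewrite scalemxAl -[s_ e i *: (V i)^T]linearZ scalemxAr /=; over.
rewrite sumrB big_split /= -mulmx_sumr -mulmx_suml.
rewrite -[\sum_i (s_ e i *: V i)^T]linear_sum /=.
by rewrite scalerDl scale1r.
Qed.

(** The bound on the slopes needs |A x|^2 and sum_i |A^T V_i x|^2, and both may
    involve the chaos itself, through a number zeta with zeta^2p = tr Z^2p.
    The product of zeta^p with a power of the constant is split by
    ab <= (a^2 + b^2)/2, and the half of tr Z^2p so produced is moved to the left. *)
Lemma chaos_moment (p : nat) (sig m : R) (y0 zeta : {ffun I -> bool} -> R) :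
  0 <= sig -> 0 <= m -> (forall e, 0 <= y0 e) ->
  24 * p.+1%:R * sig <= m ->
  (forall x : 'cV_a, \sum_i fsq ((V i)^T *m x) <= sig * fsq x) ->
  (forall x : 'cV_b, \sum_i fsq (V i *m x) <= m * fsq x) ->
  (forall e, 0 <= zeta e) ->
  (forall e, zeta e ^+ (2 * p.+1) = \tr (gram_chaos e ^+ (2 * p.+1))) ->
  (forall e (x : 'cV_b), \sum_i fsq ((sign_sum e)^T *m (V i *m x)) <=
                         (y0 e + sig * (m + zeta e)) * fsq x) ->
  \sum_e \tr (gram_chaos e ^+ (2 * p.+1)) <=
  3 * b%:R ^+ 2 * #|{ffun I -> bool}|%:R * (216 * p.+1%:R * sig * m) ^+ p.+1
  + 2 * b%:R * \sum_e (36 * p.+1%:R * y0 e) ^+ p.+1.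
Proof.
move=> sig0 m0 y00 sigm Vrow Vcol zeta0 zetaE Y.
have Zx e (x : 'cV_b) : fsq (gram_chaos e *m x) <= zeta e ^+ 2 * fsq x.
  have := fsq_mul_exp_le p x (gram_chaos_sym e).
  rewrite -zetaE exprM -exprMn => le.
  by rewrite -(@ler_pXn2r _ p.+1) // nnegrE ?mulr_ge0 ?fsq_ge0 ?exprn_ge0.
have Ax e (x : 'cV_b) : fsq (sign_sum e *m x) <= (m + zeta e) * fsq x.
  have -> : fsq (sign_sum e *m x) = \tr (x^T *m (gram_chaos e *m x)) + \sum_i fsq (V i *m x).
    have -> : \sum_i fsq (V i *m x) = \tr (x^T *m ((\sum_i (V i)^T *m V i) *m x)).
      rewrite mulmx_suml mulmx_sumr mxtrace_sum; apply: eq_bigr => i _.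
      by rewrite /fsq trmx_mul !mulmxA.
    by rewrite -mxtraceD -mulmxDr -mulmxDl subrK /fsq trmx_mul !mulmxA.
  rewrite mulrDl addrC lerD //.
  have := zeta0 e; rewrite le_eqVlt => /predU1P [z0|zpos].
    have /eqP : fsq (gram_chaos e *m x) = 0.
      apply/eqP; rewrite eq_le fsq_ge0 andbT; have := Zx e x.
      by rewrite -z0 expr0n mul0r.
    by move=> /eqP /fsq_eq0 ->; rewrite mulmx0 raddf0 -z0 mul0r.
  rewrite -(ler_pM2l zpos) -(ler_pM2l (ltr0Sn R 1)).
  have := trace_dot_le (zeta e *: x) (gram_chaos e *m x).
  rewrite -[X in \tr (_ *m X)]scale1r trace_dotZ fsqZ mulr1.
  have := Zx e x; lra.
(* The slope has three terms, with energies sig (m + zeta), y0 + sig (m + zeta) and 4 sig m. *)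
pose nu e := 3 * (6 * sig * m + 2 * sig * zeta e + y0 e).
have nu0 e : 0 <= nu e.
  by rewrite mulr_ge0 ?addr_ge0 ?mulr_ge0.
have nuP e (x : 'cV_b) : \sum_i fsq (chaos_slope i e *m x) <= nu e * fsq x.
  have bnd i : fsq (chaos_slope i e *m x) <=
     3 * (fsq ((V i)^T *m (sign_sum e *m x)) + fsq ((sign_sum e)^T *m (V i *m x))
          + 4 * fsq ((V i)^T *m (V i *m x))).
    rewrite /chaos_slope mulmxBl mulmxDl -scalemxAl -!mulmxA.
    apply: le_trans (fsq_add3_le _ _ _) _; rewrite fsqZ exprMn [_ ^+ 2]expr2.
    by rewrite [s_ e i ^+ 2]expr2 sign_sq mulr1 -natrM.
  apply: le_trans (ler_sum _ (fun i _ => bnd i)) _.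
  rewrite -mulr_sumr !big_split /= -mulr_sumr.
  have b1 : \sum_i fsq ((V i)^T *m (sign_sum e *m x)) <= sig * ((m + zeta e) * fsq x).
    by apply: le_trans (Vrow _) _; rewrite ler_wpM2l.
  have b3 : \sum_i fsq ((V i)^T *m (V i *m x)) <= sig * (m * fsq x).
    apply: le_trans (ler_wpM2l sig0 (Vcol x)); rewrite mulr_sumr.
    apply: ler_sum => i _; apply: le_trans (Vrow _).
    by rewrite (bigD1 i) //= lerDl sumr_ge0 // => j _; apply: fsq_ge0.
  have b2 := Y e x; rewrite /nu; lra.
have half : 0 <= (2^-1 : R) <= 1 by apply/andP; split; lra.
have mom := sign_moment p gram_chaos_sym chaos_slope_sym chaos_slope_flip gram_chaos_flip
  half gram_chaosE nu0 nuP.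
(* The coefficient of zeta after the three terms of nu have been separated. *)
pose c : R := 72 * p.+1%:R * sig.
have c0 : 0 <= c by rewrite !mulr_ge0.
pose X := (216 * p.+1%:R * sig * m) ^+ p.+1.
have cX : c ^+ (2 * p.+1) <= X.
  rewrite exprM; apply: lerXn2r; rewrite ?nnegrE ?exprn_ge0 ?mulr_ge0 //.
  have -> : c ^+ 2 = 216 * p.+1%:R * sig * (24 * p.+1%:R * sig) by rewrite /c; ring.
  by rewrite ler_wpM2l // !mulr_ge0.
have bnd e : b%:R * (4 * p.+1%:R * nu e) ^+ p.+1 <=
   b%:R * X + 2^-1 * (b%:R ^+ 2 * X + \tr (gram_chaos e ^+ (2 * p.+1)))
   + b%:R * (36 * p.+1%:R * y0 e) ^+ p.+1.
  have -> : 4 * p.+1%:R * nu e = 72 * p.+1%:R * sig * m + 24 * p.+1%:R * sig * zeta e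
     + 12 * p.+1%:R * y0 e by rewrite /nu; ring.
  have := exprn_add3_le p.+1 (_ : 0 <= 72 * p.+1%:R * sig * m)
     (_ : 0 <= 24 * p.+1%:R * sig * zeta e) (_ : 0 <= 12 * p.+1%:R * y0 e).
  have -> : 3 * (72 * p.+1%:R * sig * m) = 216 * p.+1%:R * sig * m by ring.
  have -> : 3 * (24 * p.+1%:R * sig * zeta e) = c * zeta e by rewrite /c; ring.
  have -> : 3 * (12 * p.+1%:R * y0 e) = 36 * p.+1%:R * y0 e by ring.
  rewrite -/X !mulr_ge0 // => /(_ isT isT isT) le0.
  have {le0}le := ler_wpM2l (ler0n R b) le0.
  apply: le_trans le _; rewrite !mulrDr lerD2r lerD2l exprMn.
  rewrite -zetaE; have := sqr_ge0 (b%:R * c ^+ p.+1 - zeta e ^+ p.+1).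
  rewrite sqrrB exprMn -!exprM !(mulnC p.+1).
  have := ler_wpM2l (sqr_ge0 (b%:R : R)) cX.
  rewrite -mulr_natl; lra.
move: mom; rewrite mulr_sumr => /le_trans /(_ (ler_sum _ (fun e _ => bnd e))).
rewrite !big_split /= -!mulr_sumr big_split /= !sumr_const -!(mulr_natl (_ * X)).
have X0 : 0 <= X by rewrite exprn_ge0 // !mulr_ge0.
have bb : #|{ffun I -> bool}|%:R * (b%:R * X) <= #|{ffun I -> bool}|%:R * (b%:R ^+ 2 * X).
  rewrite ler_wpM2l // ler_wpM2r // -natrX ler_nat expnS expn1.
  by case: (b) => // k; rewrite leq_pmulr.
rewrite -/X; lra.
Qed.
End Chaos.

(** * Scalar sign sums, scalar chaos and Markov counting *)

Section ScalarMoments.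
Variables (R : realFieldType) (I : finType).
Notation s_ := (@sign_of R I).
Notation N := (#|{ffun I -> bool}|%:R : R).

Lemma scalar_mx1X (x : R) (k : nat) : (x%:M : 'M[R]_1) ^+ k = (x ^+ k)%:M.
Proof. by rewrite (rmorphXn (@scalar_mx R 1)). Qed.

Lemma trace_scalar1X (x : R) (k : nat) : \tr ((x%:M : 'M[R]_1) ^+ k) = x ^+ k.
Proof. by rewrite scalar_mx1X mxtrace_scalar mulr1n. Qed.

(** Khintchine's inequality, as the case of sign_moment in dimension one. *)
Lemma rademacher_moment (c : I -> R) (p : nat) :
  \sum_e (\sum_i s_ e i * c i) ^+ (2 * p.+1) <=
  N * (4 * p.+1%:R * \sum_i c i ^+ 2) ^+ p.+1.
Proof.
under eq_bigr do rewrite -trace_scalar1X.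
have := @sign_moment R I 1 p (fun e => (\sum_i s_ e i * c i)%:M)
  (fun i _ => (c i)%:M) 1 (fun=> \sum_i c i ^+ 2).
rewrite sumr_const mul1r -(mulr_natl (_ ^+ _)); apply.
- by move=> e; rewrite tr_scalar_mx.
- by move=> i e; rewrite tr_scalar_mx.
- by [].
- move=> i e; rewrite scale_scalar_mx -[LHS](raddfB (@scalar_mx R 1)) /=.
  congr (_%:M).
  rewrite (bigD1 i) // [X in _ - X](bigD1 i) //= sign_flip.
  rewrite [X in _ - (_ + X)](eq_bigr (fun j => s_ e j * c j)); first by ring.
  by move=> j ji; rewrite sign_flip_neq.
- by rewrite ler01 lexx.
- move=> e; rewrite scale1r (raddf_sum (@scalar_mx R 1)).
  by apply: eq_bigr => i _ /=; rewrite scale_scalar_mx.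
- by move=> e; apply: sumr_ge0 => i _; apply: sqr_ge0.
- move=> e x; rewrite mulr_suml; apply: ler_sum => i _.
  by rewrite mul_scalar_mx fsqZ.
Qed.

(** In dimension one zeta is the absolute value of the chaos, and the cross term
    sum_i (A^T v_i)^2 is at most sig |A|^2, which is again the chaos
    plus its mean. *)
Lemma scalar_chaos_moment (a p : nat) (v : I -> 'cV[R]_a) (sig m : R) :
  0 <= sig -> 24 * p.+1%:R * sig <= m -> \sum_i fsq (v i) = m ->
  (forall y : 'cV_a, \sum_i fsq ((v i)^T *m y) <= sig * fsq y) ->
  \sum_e (fsq (sign_sum v e) - m) ^+ (2 * p.+1) <=
  3 * N * (216 * p.+1%:R * sig * m) ^+ p.+1.
Proof.
move=> sig0 sigm vm vrow.
have m0 : 0 <= m by rewrite -vm sumr_ge0 // => i _; apply: fsq_ge0.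
have chE e : gram_chaos v e = (fsq (sign_sum v e) - m)%:M.
  rewrite [LHS]mx11_scalar; congr (_%:M).
  rewrite -vm /gram_chaos !mxE; congr (_ - _); first by rewrite fsq_cV;
    apply: eq_bigr => k _; rewrite mxE expr2.
  rewrite summxE; apply: eq_bigr => i _; rewrite fsq_cV mxE.
  by apply: eq_bigr => k _; rewrite mxE expr2.
have -> : \sum_e (fsq (sign_sum v e) - m) ^+ (2 * p.+1) =
    \sum_e \tr (gram_chaos v e ^+ (2 * p.+1)).
  by apply: eq_bigr => e _; rewrite chE trace_scalar1X.
have := @chaos_moment R I a 1 v p sig m (fun=> 0)
  (fun e => `|fsq (sign_sum v e) - m|) sig0 m0.
rewrite expr1n !mulr1.
rewrite [X in _ + 2 * X]big1 ?mulr0 ?addr0; last first.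
  by move=> e _; rewrite expr0n.
apply=> //.
- move=> x; rewrite -vm mulr_suml; apply: ler_sum => i _; exact: fsq_mulmx_le.
- by move=> e; rewrite chE trace_scalar1X exprM real_normK ?num_real // -exprM.
- move=> e x; rewrite add0r.
  apply: (@le_trans _ _ ((\sum_i fsq ((v i)^T *m sign_sum v e)) * fsq x)).
    rewrite mulr_suml; apply: ler_sum => i _; rewrite mulmxA.
    apply: le_trans (fsq_mulmx_le _ _) _.
    by rewrite -[fsq (_ *m v i)]fsq_tr trmx_mul trmxK.
  rewrite ler_wpM2r ?fsq_ge0 //; apply: le_trans (vrow _) _.
  rewrite ler_wpM2l //.
  have := ler_norm (fsq (sign_sum v e) - m); lra.
Qed.
End ScalarMoments.

Lemma markov_count (R : realFieldType) (E : finType) (f : E -> R) (t : R) :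
  (forall e, 0 <= f e) -> #|[pred e | t <= f e]|%:R * t <= \sum_e f e.
Proof.
move=> f0; rewrite mulr_natl -sumr_const.
rewrite [X in _ <= X](bigID [pred e | t <= f e]) /=.
apply: le_trans (_ : _ <= \sum_(e | t <= f e) f e) _.
  by apply: ler_sum.
by rewrite lerDl sumr_ge0.
Qed.

(** Used to turn a moment into a bound: a p-th root of a sum of p-th powers dominates
    every term. *)
Lemma root_exists (R : realType) (k : nat) (c : R) :
  0 <= c -> {r : R | 0 <= r & r ^+ k.+1 = c}.
Proof.
move=> c0; exists (c `^ (k.+1%:R^-1)); first exact: powR_ge0.
rewrite -powR_mulrn ?powR_ge0 // -powRrM mulVf ?pnatr_eq0 // powRr1 //.
Qed.


(** * Cyclic correlation and the discrete Fourier transform *)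

Section Fourier.
Variables (R : realType) (n : nat).
Notation N := n.+1.

(** The angle of the (j, k) entry of the Fourier matrix, with indices in nat so that
    it is additive; reducing k modulo the dimension changes it by a multiple of 2 pi. *)
Definition phase (j k : nat) : R := 2 * pi * j%:R * k%:R / N%:R.

Definition dft_re (x : 'cV[R]_N) (j : nat) : R := \sum_(k < N) x k 0 * cos (phase j k).
Definition dft_im (x : 'cV[R]_N) (j : nat) : R := \sum_(k < N) x k 0 * sin (phase j k).
(** The squared modulus of a Fourier coefficient; real and imaginary parts are kept
    apart so that all the identities are real. *)
Definition dft_sq (x : 'cV[R]_N) (j : nat) : R := dft_re x j ^+ 2 + dft_im x j ^+ 2.

(** The matrix of cyclic correlation.  It is symmetric, and it exchanges the roles
    of the filter and of the column of Psi: the column t of H Psi is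
    hankel (col t Psi) applied to h. *)
Definition hankel (x : 'cV[R]_N) : 'M[R]_N := \matrix_(k, i) x (k + i) 0.

Lemma trmx_hankel x : (hankel x)^T = hankel x.
Proof. by apply/matrixP => i j; rewrite !mxE addrC. Qed.

Lemma hankelD x y : hankel (x + y) = hankel x + hankel y.
Proof. by apply/matrixP => i j; rewrite !mxE. Qed.

Lemma dim_neq0 : (N%:R : R) != 0. Proof. by rewrite pnatr_eq0. Qed.

Lemma phaseD (j k l : nat) : phase j (k + l) = phase j k + phase j l.
Proof. by rewrite /phase natrD; field; rewrite nat1r dim_neq0. Qed.

Lemma phase_mod (j k : nat) :
  exists q : nat, phase j k = phase j (k %% N) + (pi *+ 2) *+ q.
Proof.
exists (j * (k %/ N))%N; rewrite {1}(divn_eq k N) addnC phaseD; congr (_ + _).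
by rewrite /phase natrM -[RHS]mulr_natr natrM -mulr_natr; field; rewrite nat1r dim_neq0.
Qed.

Lemma cos_phase_mod (j k : nat) : cos (phase j (k %% N)) = cos (phase j k).
Proof. by have [q ->] := phase_mod j k; rewrite (periodicn (@cosD2pi R)). Qed.

Lemma sin_phase_mod (j k : nat) : sin (phase j (k %% N)) = sin (phase j k).
Proof. by have [q ->] := phase_mod j k; rewrite (periodicn (@sinD2pi R)). Qed.

(** Multiplying by 2 sin(pi t / n) makes the sum telescope. *)
Lemma sum_cos_phase (t : nat) : (0 < t < N)%N -> \sum_(j < N) cos (phase j t) = 0.
Proof.
move=> /andP [t0 tN]; pose phi : R := pi * t%:R / N%:R.
have Npos : (0 : R) < N%:R by rewrite ltr0n.
have s0 : 0 < sin phi.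
  apply: sin_gt0_pi; rewrite /phi divr_gt0 ?mulr_gt0 ?pi_gt0 ?ltr0n //=.
  by rewrite ltr_pdivrMr // ltr_pM2l ?pi_gt0 // ltr_nat.
have phE j : phase j t = phi * j%:R *+ 2.
  by rewrite /phase /phi -mulr_natr; field; rewrite nat1r dim_neq0.
have prod_to_sum (u v : R) :
    sin (u - v) + sin v + 2 * sin v * cos u = sin (u + v) + sin v.
  by rewrite sinB sinD; ring.
have tele (r : nat) : 2 * sin phi * \sum_(j < r) cos (phase j t) =
    sin (phi * r%:R *+ 2 - phi) + sin phi.
  elim: r => [|r IH]; first by rewrite big_ord0 !mulr0 mul0rn sub0r sinN addNr.
  rewrite big_ord_recr /= mulrDr IH phE.
  have -> : phi * r.+1%:R *+ 2 - phi = phi * r%:R *+ 2 + phi.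
    by rewrite -natr1 mulrDr mulr1 mulrnDl -addrA mulr2n addrK.
  exact: prod_to_sum.
apply/eqP; have := tele N; rewrite (_ : phi * N%:R *+ 2 - phi = - phi + (pi *+ 2) *+ t).
  rewrite (periodicn (@sinD2pi R)) sinN addNr => /eqP.
  by rewrite mulf_eq0 mulf_eq0 pnatr_eq0 (gt_eqF s0).
by rewrite addrC {2}/phi divfK ?dim_neq0 // mulr_natr mulrnAC.
Qed.

Lemma sum_cos_phaseB (k l : 'I_N) :
  \sum_(j < N) (cos (phase j k) * cos (phase j l) + sin (phase j k) * sin (phase j l))
  = (k == l)%:R * N%:R.
Proof.
wlog kl : k l / (l <= k)%N.
  move=> H; have [/H //|/ltnW /H] := leqP l k.
  rewrite eq_sym => <-; apply: eq_bigr => j _; ring.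
under eq_bigr => j _.
  have -> : cos (phase j k) * cos (phase j l) + sin (phase j k) * sin (phase j l)
     = cos (phase j (k - l)%N).
    by rewrite -cosB -{1}(subnK kl) phaseD addrK.
  over.
rewrite /=; case: eqVneq => [->|ne].
  rewrite subnn mul1r (eq_bigr (fun=> 1)) ?sumr_const ?card_ord // => j _.
  by rewrite /phase mulr0 mul0r cos0.
rewrite mul0r sum_cos_phase //; have lk : (k : nat) != l by [].
by have := ltn_ord k; lia.
Qed.

Lemma parseval (x : 'cV[R]_N) : \sum_(j < N) dft_sq x j = N%:R * fsq x.
Proof.
have -> : \sum_(j < N) dft_sq x j = \sum_(j < N) \sum_(k < N) \sum_(l < N)
   x k 0 * x l 0 * (cos (phase j k) * cos (phase j l) + sin (phase j k) * sin (phase j l)).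
  apply: eq_bigr => j _; rewrite /dft_sq !expr2 /dft_re /dft_im !mulr_suml -big_split /=.
  apply: eq_bigr => k _; rewrite !mulr_sumr -big_split /=.
  by apply: eq_bigr => l _; ring.
rewrite exchange_big fsq_cV mulr_sumr; apply: eq_bigr => k _ /=.
rewrite exchange_big (bigD1 k) //= -mulr_sumr sum_cos_phaseB eqxx mul1r -expr2.
rewrite big1 ?addr0 1?mulrC // => l lk.
by rewrite -mulr_sumr sum_cos_phaseB eq_sym (negbTE lk) mul0r mulr0.
Qed.

(** The correlation theorem: the transform of a correlation is the product of one
    transform with the conjugate of the other. *)
Lemma dft_sq_hankel (x a : 'cV[R]_N) (j : nat) :
  dft_sq (hankel x *m a) j = dft_sq x j * dft_sq a j.
Proof.
have cosE (i k : 'I_N) : cos (phase j i) = cos (phase j (i + k)%R) * cos (phase j k)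
     + sin (phase j (i + k)%R) * sin (phase j k).
  by rewrite [nat_of_ord (i + k)%R]/= cos_phase_mod sin_phase_mod -cosB phaseD addrK.
have sinE (i k : 'I_N) : sin (phase j i) = sin (phase j (i + k)%R) * cos (phase j k)
     - cos (phase j (i + k)%R) * sin (phase j k).
  by rewrite [nat_of_ord (i + k)%R]/= cos_phase_mod sin_phase_mod -sinB phaseD addrK.
have reE (k : 'I_N) : dft_re x j = \sum_(i < N) x (i + k) 0 * cos (phase j (i + k)%R).
  by rewrite /dft_re (reindex_inj (@addIr _ k)).
have imE (k : 'I_N) : dft_im x j = \sum_(i < N) x (i + k) 0 * sin (phase j (i + k)%R).
  by rewrite /dft_im (reindex_inj (@addIr _ k)).
have re : dft_re (hankel x *m a) j = dft_re x j * dft_re a j + dft_im x j * dft_im a j.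
  rewrite [LHS]/dft_re; under eq_bigr do rewrite mxE mulr_suml.
  rewrite exchange_big [dft_re a j]/dft_re [dft_im a j]/dft_im !mulr_sumr -big_split.
  apply: eq_bigr => k _ /=.
  rewrite (reE k) (imE k).
  rewrite !mulr_suml -big_split; apply: eq_bigr => i _ /=.
  by rewrite mxE (cosE i k); ring.
have im : dft_im (hankel x *m a) j = dft_im x j * dft_re a j - dft_re x j * dft_im a j.
  rewrite [LHS]/dft_im; under eq_bigr do rewrite mxE mulr_suml.
  rewrite exchange_big [dft_re a j]/dft_re [dft_im a j]/dft_im !mulr_sumr -sumrB.
  apply: eq_bigr => k _ /=.
  rewrite (reE k) (imE k).
  rewrite !mulr_suml -sumrB; apply: eq_bigr => i _ /=.
  by rewrite mxE (sinE i k); ring.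
by rewrite /dft_sq re im; ring.
Qed.

Lemma fsq_hankel_le (x a : 'cV[R]_N) (B : R) :
  (forall j : 'I_N, dft_sq x j <= B) -> fsq (hankel x *m a) <= B * fsq a.
Proof.
move=> xB; rewrite -(@ler_pM2l _ (N%:R)) ?ltr0n // -parseval mulrCA -parseval.
rewrite mulr_sumr; apply: ler_sum => j _; rewrite dft_sq_hankel ler_wpM2r //.
by rewrite addr_ge0 ?sqr_ge0.
Qed.

(** Correlation is symmetric in its two arguments, so a bound on the spectrum of
    either of them controls the norm. *)
Lemma fsq_hankel_le_dual (x a : 'cV[R]_N) (B : R) :
  (forall j : 'I_N, dft_sq a j <= B) -> fsq (hankel x *m a) <= B * fsq x.
Proof.
move=> aB; rewrite -(@ler_pM2l _ (N%:R)) ?ltr0n // -parseval mulrCA -parseval.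
rewrite mulr_sumr; apply: ler_sum => j _; rewrite dft_sq_hankel mulrC ler_wpM2r //.
by rewrite addr_ge0 ?sqr_ge0.
Qed.

Lemma dft_sq_le_coherence (Psi : 'M[R]_N) (t j : 'I_N) :
  dft_sq (col t Psi) j <= coherence (dft_mx R N) Psi ^+ 2.
Proof.
set F := dft_mx R N *m map_mx (real_complex R) Psi.
have FE : F j t = Complex (dft_re (col t Psi) j) (- dft_im (col t Psi) j).
  rewrite /F mxE /dft_re /dft_im -sumrN.
  elim/big_rec3: _ => [//|k u v w _ ->].
  rewrite !mxE /expi cosN sinN -[2 * pi * _ * _ / _]/(phase j k) /=.
  by simpc; congr (Complex _ _); ring.
have le : Num.sqrt (dft_sq (col t Psi) j) <= coherence (dft_mx R N) Psi.
  have -> : Num.sqrt (dft_sq (col t Psi) j) = Normc.normc (F j t).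
    by rewrite FE /= sqrrN.
  apply: le_trans (le_bigmax _ (fun t => Normc.normc (F j t)) t) _.
  exact: (le_bigmax _ (fun j => \big[Num.max/0]_(t < N) Normc.normc (F j t)) j).
have d0 : 0 <= dft_sq (col t Psi) j by rewrite addr_ge0 ?sqr_ge0.
rewrite -(sqr_sqrtr d0); apply: lerXn2r => //; rewrite nnegrE ?sqrtr_ge0 //.
exact: le_trans (sqrtr_ge0 _) le.
Qed.

(** Read through the iterates of the cyclic successor, since each power of the shift
    moves the entries of the row by one place. *)
Lemma circulantE (h : 'rV[R]_N) (k j : 'I_N) : circulant_mx h k j = h 0 (j - k)%R.
Proof.
have shiftX (r : nat) (i : 'I_N) : (h *m shift_mx R N ^+ r) 0 (iter r (@ordS N) i) = h 0 i.
  elim: r => [|r IH]; first by rewrite expr0 mulmx1.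
  rewrite exprSr -mulmxE mulmxA mxE (bigD1 (iter r (@ordS N) i)) //= IH mxE eqxx mulr1.
  rewrite big1 ?addr0 // => l li; rewrite [shift_mx R N _ _]mxE (inj_eq (@ordS_inj _)).
  by rewrite eq_sym (negbTE li) mulr0.
have iterE (r : nat) (i : 'I_N) : (iter r (@ordS N) i = (i + r) %% N :> nat)%N.
  elim: r => [|r IH]; first by rewrite addn0 modn_small.
  by rewrite iterS /= IH -addn1 modnDml addn1 addnS.
rewrite mxE -(shiftX k); congr ((_ *m _) _ _); apply: ord_inj.
by rewrite iterE -{1}(subrK k j).
Qed.
End Fourier.

(** * Coordinate masks *)

(** Restriction to a set of coordinates as a square matrix.  Selecting rows and
    columns by masks keeps all matrices of size n. *)
Definition mask (R : realType) (n : nat) (A : {set 'I_n}) : 'M[R]_n :=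
  diag_mx (\row_k (k \in A)%:R).

Definition sign_vec (R : realType) (n : nat) (e : {ffun 'I_n -> bool}) : 'cV[R]_n :=
  \col_i sign_of R e i.

Section Mask.
Variables (R : realType) (n : nat).
Implicit Types (A : {set 'I_n}) (x : 'cV[R]_n).

Lemma mask_mulE A x k : (mask R A *m x) k 0 = (k \in A)%:R * x k 0.
Proof. by rewrite /mask mul_diag_mx !mxE. Qed.

Lemma trmx_mask A : (mask R A)^T = mask R A.
Proof. exact: tr_diag_mx. Qed.

Lemma mask_idem A : mask R A *m mask R A = mask R A.
Proof.
apply/matrixP => i j; rewrite /mask mul_diag_mx !mxE.
by case: (i \in A); rewrite ?mul1r // mul0r mul0rn.
Qed.

Lemma fsq_mask A x : fsq (mask R A *m x) = \sum_(k in A) x k 0 ^+ 2.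
Proof.
rewrite fsq_cV [RHS]big_mkcond; apply: eq_bigr => k _; rewrite mask_mulE.
by case: (k \in A); rewrite ?mul1r // mul0r expr0n.
Qed.

Lemma fsq_mask_le A x : fsq (mask R A *m x) <= fsq x.
Proof.
rewrite fsq_mask fsq_cV [leRHS](bigID (mem A)) /= lerDl.
by apply: sumr_ge0 => k _; apply: sqr_ge0.
Qed.
End Mask.


(** * Moments of sampled random convolutions *)

Section Convolution.
Variables (R : realType) (n : nat) (Om : {set 'I_n.+1}).
Notation N := n.+1.
Notation cube := {ffun 'I_N -> bool}.
Notation m := (#|Om|%:R : R).
Notation sv := (@sign_vec R N).

Lemma dft_sq_ge0 (x : 'cV[R]_N) j : 0 <= dft_sq x j.
Proof. by rewrite addr_ge0 ?sqr_ge0. Qed.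

Lemma sum_fsq_mask_hankel (x : 'cV[R]_N) :
  \sum_i fsq (mask R Om *m col i (hankel x)) = m * fsq x.
Proof.
under eq_bigr do rewrite fsq_mask.
rewrite exchange_big /= mulr_natl -sumr_const; apply: eq_bigr => k _.
rewrite fsq_cV [RHS](reindex_inj (@addrI _ k)) /=.
by apply: eq_bigr => i _; rewrite !mxE.
Qed.

Lemma sign_sum_mask_hankel (x : 'cV[R]_N) e :
  sign_sum (fun i => mask R Om *m col i (hankel x)) e = mask R Om *m (hankel x *m sv e).
Proof.
rewrite /sign_sum; under eq_bigr do rewrite scalemxAr.
rewrite -mulmx_sumr; congr (_ *m _); apply/matrixP => k j; rewrite ord1 summxE mxE.
by apply: eq_bigr => i _; rewrite !mxE mulrC.
Qed.

(** The energy of the samples of one random convolution is a scalar chaos of which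
    the coefficients are the columns of a masked correlation matrix. *)
Lemma conv_chaos_moment (x : 'cV[R]_N) (q : R) (p : nat) :
  0 <= q -> (forall j : 'I_N, dft_sq x j <= q) -> 24 * p.+1%:R * q <= m * fsq x ->
  \sum_e (fsq (mask R Om *m (hankel x *m sv e)) - m * fsq x) ^+ (2 * p.+1) <=
  3 * #|{ffun 'I_N -> bool}|%:R * (216 * p.+1%:R * q * (m * fsq x)) ^+ p.+1.
Proof.
move=> q0 xq qm; under eq_bigr do rewrite -sign_sum_mask_hankel.
apply: scalar_chaos_moment => //; first exact: sum_fsq_mask_hankel.
move=> y; have -> : \sum_i fsq ((mask R Om *m col i (hankel x))^T *m y) =
    fsq (hankel x *m (mask R Om *m y)).
  rewrite [RHS]fsq_cV; apply: eq_bigr => i _.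
  rewrite trmx_mul trmx_mask -mulmxA tr_col trmx_hankel -row_mul fsq_cV big_ord1.
  by rewrite mxE.
by apply: le_trans (fsq_hankel_le _ xq) _; rewrite ler_wpM2l // fsq_mask_le.
Qed.

(** A linear functional of the samples is a sign sum; moving the mask and the
    symmetric correlation matrix to the other side shows its coefficients. *)
Lemma linear_moment (x : 'cV[R]_N) (q : R) (p : nat) (c : 'I_N -> R) :
  0 <= q -> (forall j : 'I_N, dft_sq x j <= q) -> (forall k, c k ^+ 2 <= 1) ->
  \sum_(e : cube) (\sum_k (mask R Om *m (hankel x *m sv e)) k 0 * c k) ^+ (2 * p.+1) <=
  #|{ffun 'I_N -> bool}|%:R * (4 * p.+1%:R * (q * m)) ^+ p.+1.
Proof.
move=> q0 xq c1; pose d := hankel x *m (mask R Om *m \col_k c k).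
have dE e : \sum_k (mask R Om *m (hankel x *m sv e)) k 0 * c k =
    \sum_i sign_of R e i * d i 0.
  have -> : \sum_i sign_of R e i * d i 0 = ((sv e)^T *m d) 0 0.
    by rewrite mxE; apply: eq_bigr => i _; rewrite !mxE.
  have -> : (sv e)^T *m d = (mask R Om *m (hankel x *m sv e))^T *m \col_k c k.
    by rewrite /d !trmx_mul trmx_mask trmx_hankel !mulmxA.
  by rewrite [RHS]mxE; apply: eq_bigr => k _; rewrite [in RHS]mxE [X in _ = _ * X]mxE.
under eq_bigr do rewrite dE.
apply: le_trans (rademacher_moment _ _) _; rewrite ler_wpM2l //.
have d0 : 0 <= \sum_i d i 0 ^+ 2 by apply: sumr_ge0 => i _; apply: sqr_ge0.
have m0 : 0 <= m by [].
apply: lerXn2r; rewrite ?nnegrE ?mulr_ge0 // ler_wpM2l ?mulr_ge0 //.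
rewrite -fsq_cV; apply: le_trans (fsq_hankel_le _ xq) _; rewrite ler_wpM2l //.
by rewrite fsq_mask -sumr_const ler_sum // => k _; rewrite mxE.
Qed.

(** Real and imaginary parts are sign sums of variance at most q times the number
    of samples. *)
Lemma dft_moment (x : 'cV[R]_N) (q : R) (p j : nat) :
  0 <= q -> (forall j : 'I_N, dft_sq x j <= q) ->
  \sum_(e : cube) dft_sq (mask R Om *m (hankel x *m sv e)) j ^+ p.+1 <=
  2 * #|{ffun 'I_N -> bool}|%:R * (8 * p.+1%:R * (q * m)) ^+ p.+1.
Proof.
move=> q0 xq.
have bnd (u v : R) : (u ^+ 2 + v ^+ 2) ^+ p.+1 <=
    2 ^+ p.+1 * (u ^+ (2 * p.+1) + v ^+ (2 * p.+1)).
  rewrite mulrDr !exprM -!exprMn.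
  by apply: exprn_add2_le; apply: sqr_ge0.
apply: le_trans (ler_sum _ (fun e _ => bnd (dft_re _ j) (dft_im _ j))) _.
rewrite -mulr_sumr big_split /=.
have hs := @linear_moment x q p (fun k => sin (phase R n j k)) q0 xq
  ltac:(by move=> k; rewrite sin2cos2 lerBlDr lerDl sqr_ge0).
have hc := @linear_moment x q p (fun k => cos (phase R n j k)) q0 xq
  ltac:(by move=> k; rewrite cos2sin2 lerBlDr lerDl sqr_ge0).
have -> : 8 * p.+1%:R * (q * m) = 2 * (4 * p.+1%:R * (q * m)) by ring.
rewrite [(2 * _) ^+ _]exprMn mulrCA; rewrite ler_wpM2l ?exprn_ge0 //.
apply: le_trans (lerD hc hs) _; lra.
Qed.
End Convolution.

(** * The Gram matrix of the columns in T *)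

Section MatrixMoment.
Variables (R : realType) (n : nat) (Psi : 'M[R]_n.+1) (T Om : {set 'I_n.+1}).
Notation N := n.+1.
Notation cube := {ffun 'I_N -> bool}.
Notation m := (#|Om|%:R : R).
Notation S := (#|T|%:R : R).
Notation sv := (@sign_vec R N).
Hypothesis orthoPsi : Psi^T *m Psi = 1%:M.
Variable q : R.
Hypothesis q0 : 0 <= q.
Hypothesis Psiq : forall t j : 'I_N, dft_sq (col t Psi) j <= q.

(** The sampled matrix for the sign pattern e, with the unsampled rows set to 0. *)
Definition sensing_mx (e : cube) : 'M[R]_N :=
  \matrix_(k, t) (mask R Om *m (hankel (col t Psi) *m sv e)) k 0.

(** The coefficient of the sign i in the matrix of the columns in T. *)
Definition sensing_slice (i : 'I_N) : 'M[R]_N :=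
  mask R Om *m (\matrix_(k, t) Psi (k + i) t) *m mask R T.

Lemma fsq_ortho (x : 'cV[R]_N) : fsq (Psi *m x) = fsq x.
Proof. by rewrite /fsq trmx_mul mulmxA -(mulmxA x^T) orthoPsi mulmx1. Qed.

Lemma sensing_slice_mul i (x : 'cV[R]_N) :
  sensing_slice i *m x = mask R Om *m col i (hankel (Psi *m (mask R T *m x))).
Proof.
rewrite /sensing_slice -!mulmxA; congr (_ *m _); apply/matrixP => k j.
by rewrite !ord1 !mxE; apply: eq_bigr => l _; rewrite mxE.
Qed.

Lemma sign_sum_sliceE e : sign_sum sensing_slice e = sensing_mx e *m mask R T.
Proof.
rewrite /sign_sum /sensing_slice; under eq_bigr do rewrite scalemxAl scalemxAr.
rewrite -mulmx_suml -mulmx_sumr; congr (_ *m _); apply/matrixP => k l.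
rewrite [RHS]mxE mask_mulE /mask mul_diag_mx !mxE; congr (_ * _); rewrite summxE.
by apply: eq_bigr => i _; rewrite !mxE mulrC.
Qed.

Lemma col_sign_sum_slice e t :
  col t (sign_sum sensing_slice e) =
  (t \in T)%:R *: (mask R Om *m (hankel (col t Psi) *m sv e)).
Proof.
rewrite sign_sum_sliceE /mask mul_mx_diag; apply/colP => k.
by rewrite !mxE mulrC.
Qed.

Lemma slice_row_bound (y : 'cV[R]_N) :
  \sum_i fsq ((sensing_slice i)^T *m y) <= S * q * fsq y.
Proof.
have E i : fsq ((sensing_slice i)^T *m y) =
    \sum_(t in T) (hankel (col t Psi) *m (mask R Om *m y)) i 0 ^+ 2.
  rewrite /sensing_slice !trmx_mul !trmx_mask -!mulmxA fsq_mask.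
  apply: eq_bigr => t _; congr (_ ^+ 2); rewrite !mxE; apply: eq_bigr => k _.
  by rewrite !mxE addrC.
under eq_bigr do rewrite E.
rewrite exchange_big /= -mulrA mulr_natl -sumr_const; apply: ler_sum => t _.
rewrite -fsq_cV; apply: le_trans (fsq_hankel_le _ (Psiq t)) _.
by rewrite ler_wpM2l // fsq_mask_le.
Qed.

Lemma slice_col_bound (x : 'cV[R]_N) :
  \sum_i fsq (sensing_slice i *m x) <= m * fsq x.
Proof.
under eq_bigr do rewrite sensing_slice_mul.
by rewrite sum_fsq_mask_hankel fsq_ortho ler_wpM2l // fsq_mask_le.
Qed.

Lemma sum_slice_gram :
  \sum_i (sensing_slice i)^T *m sensing_slice i = m *: mask R T.
Proof.
have E : \sum_i (sensing_slice i)^T *m sensing_slice i = mask R T *m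
   (\sum_i (\matrix_(k, t) Psi (k + i) t)^T *m (mask R Om *m \matrix_(k, t) Psi (k + i) t))
   *m mask R T.
  rewrite mulmx_sumr mulmx_suml; apply: eq_bigr => i _.
  rewrite /sensing_slice !trmx_mul !trmx_mask -!mulmxA.
  by rewrite (mulmxA (mask R Om) (mask R Om)) mask_idem.
rewrite E (_ : \sum_i _ = m%:M); first by rewrite mul_mx_scalar -scalemxAl mask_idem.
apply/matrixP => s t; rewrite summxE.
under eq_bigr => i _.
  rewrite mxE.
  under eq_bigr => k _ do rewrite /mask mul_diag_mx !mxE.
  over.
have inner k : \sum_i Psi (k + i) s * ((k \in Om)%:R * Psi (k + i) t) =
    (k \in Om)%:R * (s == t)%:R.
  under eq_bigr do rewrite mulrCA; rewrite -mulr_sumr; congr (_ * _).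
  have /matrixP /(_ s t) := orthoPsi; rewrite !mxE => <-.
  rewrite [RHS](reindex_inj (@addrI _ k)) /=.
  by apply: eq_bigr => i _; rewrite mxE.
rewrite exchange_big /= (eq_bigr _ (fun k _ => inner k)).
rewrite -mulr_suml mxE -[RHS]mulr_natr; congr (_ * _).
rewrite -sum1_card natr_sum [RHS]big_mkcond.
by apply: eq_bigr => k _; case: (k \in Om).
Qed.

(** Exchanging the roles of x and of the samples turns the sum over i into the
    energy of correlations with the columns of the sampled matrix, whose spectrum
    is bounded by B.  A bound on the norm of the matrix alone would be of the order
    of the number of samples, which is too large. *)
Lemma slice_cross_bound e (B : R) (x : 'cV[R]_N) :
  (forall t j : 'I_N, t \in T ->
     dft_sq (mask R Om *m (hankel (col t Psi) *m sv e)) j <= B) ->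
  \sum_i fsq ((sign_sum sensing_slice e)^T *m (sensing_slice i *m x)) <= S * B * fsq x.
Proof.
move=> dB; set x' := Psi *m (mask R T *m x).
have E i : fsq ((sign_sum sensing_slice e)^T *m (sensing_slice i *m x)) =
   \sum_(t in T) (hankel x' *m (mask R Om *m (hankel (col t Psi) *m sv e))) i 0 ^+ 2.
  rewrite sensing_slice_mul -/x' fsq_cV [RHS]big_mkcond; apply: eq_bigr => t _.
  have -> : ((sign_sum sensing_slice e)^T *m (mask R Om *m col i (hankel x'))) t 0 =
     ((col t (sign_sum sensing_slice e))^T *m (mask R Om *m col i (hankel x'))) 0 0.
    by rewrite !mxE; apply: eq_bigr => k _; rewrite !mxE.
  rewrite col_sign_sum_slice; case: (t \in T); last first.
    by rewrite scale0r trmx0 mul0mx mxE expr0n.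
  rewrite scale1r trmx_mul trmx_mask -(mulmxA _ (mask R Om) (mask R Om *m _)).
  rewrite (mulmxA (mask R Om) (mask R Om)) mask_idem mulmxA.
  rewrite -[in LHS](trmx_mask R Om) -trmx_mul; congr (_ ^+ 2).
  by rewrite !mxE; apply: eq_bigr => k _; rewrite !mxE mulrC addrC.
under eq_bigr do rewrite E.
rewrite exchange_big /= -mulrA mulr_natl -sumr_const; apply: ler_sum => t tT.
rewrite -fsq_cV; apply: le_trans (fsq_hankel_le_dual _ (fun j => dB t j tT)) _.
have [B0|B0] := lerP 0 B; last first.
  by have := le_lt_trans (dB t 0 tT) B0; rewrite ltNge dft_sq_ge0.
by rewrite ler_wpM2l // /x' fsq_ortho fsq_mask_le.
Qed.

Definition gram_error (e : cube) : 'M[R]_N :=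
  (sensing_mx e *m mask R T)^T *m (sensing_mx e *m mask R T) - m *: mask R T.

Lemma gram_errorE e : gram_error e = gram_chaos sensing_slice e.
Proof. by rewrite /gram_chaos sum_slice_gram sign_sum_sliceE. Qed.

(** The number B e is the p-th root of the sum of the p-th powers of all the Fourier
    coefficients of the sampled columns in T: it dominates each of them, and its
    moment is bounded by dft_moment. *)
Lemma gram_error_moment (p : nat) :
  24 * p.+1%:R * (S * q) <= m ->
  \sum_e \tr (gram_error e ^+ (2 * p.+1)) <=
  7 * N%:R ^+ 3 * #|{ffun 'I_N -> bool}|%:R * (288 * (p.+1%:R ^+ 2 * S * q * m)) ^+ p.+1.
Proof.
move=> hm; under eq_bigr do rewrite gram_errorE.
pose a t e := mask R Om *m (hankel (col t Psi) *m sv e).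
have sum0 e : 0 <= \sum_(t in T) \sum_(j < N) dft_sq (a t e) j ^+ p.+1.
  by do 2!apply: sumr_ge0 => ? _; rewrite exprn_ge0 ?dft_sq_ge0.
pose B e := s2val (root_exists p (sum0 e)).
have B0 e : 0 <= B e by exact: (s2valP (root_exists p (sum0 e))).
have BE e : B e ^+ p.+1 = \sum_(t in T) \sum_(j < N) dft_sq (a t e) j ^+ p.+1.
  exact: (s2valP' (root_exists p (sum0 e))).
have dB e t (j : 'I_N) : t \in T -> dft_sq (a t e) j <= B e.
  move=> tT; rewrite -(@ler_pXn2r _ p.+1) ?nnegrE ?dft_sq_ge0 // BE.
  rewrite (bigD1 t) //= (bigD1 j) //= -addrA lerDl.
  have pow_ge0 u k : 0 <= dft_sq (a u e) k ^+ p.+1 by rewrite exprn_ge0 ?dft_sq_ge0.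
  by rewrite addr_ge0 // sumr_ge0 // => u _; rewrite sumr_ge0.
have EB : \sum_e B e ^+ p.+1 <=
    S * N%:R * (2 * #|{ffun 'I_N -> bool}|%:R * (8 * p.+1%:R * (q * m)) ^+ p.+1).
  under eq_bigr do rewrite BE.
  rewrite exchange_big /= -mulrA mulr_natl -sumr_const; apply: ler_sum => t _.
  rewrite exchange_big /= mulr_natl -[X in _ *+ X]card_ord -sumr_const.
  by apply: ler_sum => j _; apply: dft_moment.
have tr0 e : 0 <= \tr (gram_chaos sensing_slice e ^+ (2 * p.+1)).
  by rewrite trace_exp_even ?fsq_ge0 // gram_chaos_sym.
pose z e := s2val (root_exists (2 * p.+1).-1 (tr0 e)).
have z0 e : 0 <= z e by exact: (s2valP (root_exists (2 * p.+1).-1 (tr0 e))).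
have zE e : z e ^+ (2 * p.+1) = \tr (gram_chaos sensing_slice e ^+ (2 * p.+1)).
  exact: (s2valP' (root_exists (2 * p.+1).-1 (tr0 e))).
have Sq0 : 0 <= S * q by rewrite mulr_ge0.
have := @chaos_moment R _ N N sensing_slice p (S * q) m (fun e => S * B e) z
  Sq0 (ler0n _ _) (fun e => mulr_ge0 (ler0n _ _) (B0 e)) hm
  slice_row_bound slice_col_bound z0 zE.
have Y e (x : 'cV_N) : \sum_i fsq ((sign_sum sensing_slice e)^T *m (sensing_slice i *m x)) <=
   (S * B e + S * q * (m + z e)) * fsq x.
  apply: le_trans (@slice_cross_bound e (B e) x _) _; first by move=> t j; apply: dB.
  by rewrite ler_wpM2r ?fsq_ge0 // lerDl mulr_ge0 ?addr_ge0.
move=> /(_ Y) /le_trans; apply.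
set C : R := #|{ffun 'I_N -> bool}|%:R in EB *.
have C0 : 0 <= C by [].
set P : R := p.+1%:R in EB hm *.
have P1 : 1 <= P by rewrite ler1n.
have P0 : 0 <= P by [].
have w0 : 0 <= P ^+ 2 * S * q * m by rewrite mulr_ge0 // mulr_ge0 // mulr_ge0 // exprn_ge0.
set X := (288 * _) ^+ p.+1.
have X0 : 0 <= X by apply: exprn_ge0; apply: (mulr_ge0 (ler0n _ _) w0).
have PS0 : 0 <= P * S by rewrite mulr_ge0.
have e2 : \sum_e (36 * P * (S * B e)) ^+ p.+1 <= S * N%:R * (2 * C) * X.
  have E e : (36 * P * (S * B e)) ^+ p.+1 = (36 * (P * S)) ^+ p.+1 * B e ^+ p.+1.
    by rewrite -exprMn !mulrA.
  rewrite (eq_bigr _ (fun e _ => E e)) -mulr_sumr.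
  apply: le_trans (ler_wpM2l _ EB) _; first by rewrite exprn_ge0 // (mulr_ge0 (ler0n _ _)).
  have -> : X = (36 * (P * S)) ^+ p.+1 * (8 * P * (q * m)) ^+ p.+1.
    by rewrite -exprMn /X; congr (_ ^+ _); ring.
  by rewrite le_eqVlt; apply/orP; left; apply/eqP; ring.
have e1 : (216 * P * (S * q) * m) ^+ p.+1 <= X.
  have PSqm : 0 <= P * (S * q * m) by rewrite mulr_ge0 // mulr_ge0.
  have e : 216 * P * (S * q) * m = 216 * (P * (S * q * m)) by ring.
  have e' : 288 * (P ^+ 2 * S * q * m) = 288 * (P * (P * (S * q * m))) by ring.
  have le : P * (S * q * m) <= P * (P * (S * q * m)).
    by rewrite -[leLHS]mul1r ler_wpM2r.
  rewrite /X e e'; apply: lerXn2r; rewrite ?nnegrE.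
  - exact: (mulr_ge0 (ler0n _ _)).
  - by apply: (mulr_ge0 (ler0n _ _)); rewrite mulr_ge0.
  - by lra.
have SN : S <= N%:R by rewrite ler_nat -[leqRHS](card_ord N) max_card.
have N1 : (1 : R) <= N%:R by rewrite ler1n.
set M := N%:R in SN N1 e2 *.
have CX0 : 0 <= C * X by rewrite mulr_ge0.
have MM0 : 0 <= M ^+ 2 * (C * X) by rewrite mulr_ge0 ?exprn_ge0.
have f1 : M ^+ 2 * C * (216 * P * (S * q) * m) ^+ p.+1 <= M ^+ 3 * (C * X).
  apply: (@le_trans _ _ (M ^+ 2 * C * X)); first by rewrite ler_wpM2l // mulr_ge0 ?exprn_ge0.
  rewrite (_ : M ^+ 2 * C * X = M ^+ 2 * (C * X)); last ring.
  rewrite (_ : M ^+ 3 * (C * X) = M * (M ^+ 2 * (C * X))); last ring.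
  by rewrite ler_peMl.
have f2 : M * \sum_e (36 * P * (S * B e)) ^+ p.+1 <= 2 * M ^+ 3 * (C * X).
  apply: le_trans (ler_wpM2l _ e2) _ => //.
  rewrite (_ : M * (S * M * (2 * C) * X) = 2 * (S * (M ^+ 2 * (C * X)))); last ring.
  rewrite (_ : 2 * M ^+ 3 * (C * X) = 2 * (M * (M ^+ 2 * (C * X)))); last ring.
  by rewrite ler_wpM2l // ler_wpM2r.
move: f1 f2; set U := _ ^+ p.+1; set W := \sum_e _; clear.
lra.
Qed.
End MatrixMoment.

(** * A dual certificate for l1 recovery *)

Section Certificate.
Variables (R : realType) (n : nat) (T : {set 'I_n}).

(** Duality: the l1 norm of x0 is the pairing of x0 with B^T w, which is the same for
    b, and for b it is at most the l1 norm, with equality only if b vanishes off T. *)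
Lemma l1_certificate (B : 'M[R]_n) (x0 b w : 'cV[R]_n) :
  (forall t, t \notin T -> x0 t 0 = 0) ->
  (forall t, t \in T -> (B^T *m w) t 0 = Num.sg (x0 t 0)) ->
  (forall t, t \notin T -> `|(B^T *m w) t 0| < 1) ->
  (forall x : 'cV_n, (forall t, t \notin T -> x t 0 = 0) -> B *m x = 0 -> x = 0) ->
  B *m b = B *m x0 ->
  l1norm x0 <= l1norm b /\ (l1norm b <= l1norm x0 -> b = x0).
Proof.
move=> x0T yT yC inj Bb; set y := B^T *m w in yT yC.
have dual (x : 'cV_n) : \sum_t x t 0 * y t 0 = ((B *m x)^T *m w) 0 0.
  rewrite trmx_mul -mulmxA -/y mxE.
  by apply: eq_bigr => t _; rewrite [in RHS]mxE.
have x0E : l1norm x0 = \sum_t x0 t 0 * y t 0.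
  apply: eq_bigr => t _; have [tT|tT] := boolP (t \in T).
    by rewrite yT // mulrC -normrEsg.
  by rewrite x0T // normr0 mul0r.
have yle t : `|y t 0| <= 1.
  have [tT|tT] := boolP (t \in T); last exact/ltW/yC.
  by rewrite yT // normr_sg; case: (_ != 0).
have term t : b t 0 * y t 0 <= `|b t 0|.
  apply: le_trans (ler_norm _) _; rewrite normrM.
  by rewrite ler_piMr.
have le : l1norm x0 <= l1norm b.
  by rewrite x0E dual -Bb -dual; apply: ler_sum.
split=> // ge.
have sum0 : \sum_t (`|b t 0| - b t 0 * y t 0) = 0.
  rewrite sumrB [X in _ - X]dual Bb -dual -x0E -/(l1norm b).
  by apply/eqP; rewrite subr_eq0 eq_le ge le.
have each t : `|b t 0| = b t 0 * y t 0.
  move/eqP: sum0; rewrite psumr_eq0 => [|k _]; last by rewrite subr_ge0.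
  by move/allP/(_ t (mem_index_enum _)); rewrite subr_eq0 => /eqP.
have bT t : t \notin T -> b t 0 = 0.
  move=> tT; apply/eqP; rewrite -normr_eq0; apply/negPn/negP => b0.
  have bpos : 0 < `|b t 0| by rewrite lt_def b0 normr_ge0.
  have := each t; move/eqP; apply/negP; rewrite gt_eqF //.
  apply: le_lt_trans (ler_norm _) _; rewrite normrM.
  by rewrite gtr_pMr // yC.
apply/eqP; rewrite -subr_eq0; apply/eqP; apply: inj; last by rewrite mulmxBr Bb subrr.
by move=> t tT; rewrite !mxE bT // x0T // subr0.
Qed.

Variables (B : 'M[R]_n) (m : R).
Let A := B *m mask R T.
Let Z := A^T *m A - m *: mask R T.
(** Equal to A^T A on the coordinates in T and to m off T, so that inverting it
    inverts A^T A without a change of dimension. *)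
Definition shifted_gram : 'M[R]_n :=
  m%:M + ((B *m mask R T)^T *m (B *m mask R T) - m *: mask R T).

Hypothesis m_gt0 : 0 < m.
Hypothesis Zsmall : forall x : 'cV[R]_n, fsq (Z *m x) <= (m / 2) ^+ 2 * fsq x.

(** The part that the error takes from m x has norm at most m/2 times that of x. *)
Lemma shifted_gram_lower (x : 'cV[R]_n) :
  (m / 2) ^+ 2 * fsq x <= fsq (shifted_gram *m x).
Proof.
have e : m *: x = shifted_gram *m x - Z *m x.
  by rewrite /shifted_gram mulmxDl addrK mul_scalar_mx.
have := fsq_ge0 (shifted_gram *m x + Z *m x); rewrite fsqD.
have := fsqZ m x; rewrite e fsqD fsqN mulmxN raddfN /=.
have := Zsmall x; rewrite expr_div_n.
set u := fsq (_ *m x); set v := fsq _; set w := fsq x; set c := \tr _.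
move: (m ^+ 2) => M; lra.
Qed.

Lemma shifted_gram_unit : shifted_gram \in unitmx.
Proof.
rewrite -unitmx_tr -row_free_unit -kermx_eq0; apply/eqP.
set K := kermx _; apply: (can_inj (@trmxK _ _ _)); rewrite trmx0.
have K0 : shifted_gram *m K^T = 0.
  apply: (can_inj (@trmxK _ _ _)); rewrite trmx_mul trmxK mulmx_ker trmx0 //.
apply/matrixP => i j; have : fsq (col j K^T) = 0.
  have := shifted_gram_lower (col j K^T).
  rewrite [in X in _ <= X]colE mulmxA K0 mul0mx [X in _ <= X]/fsq.
  rewrite mulmx0 raddf0 => le; apply/eqP; rewrite eq_le [X in _ && X]fsq_ge0 andbT.
  by move: le; rewrite pmulr_rle0 // exprn_gt0 // divr_gt0.
by move=> /fsq_eq0 /colP /(_ i); rewrite !mxE.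
Qed.

Lemma shifted_gram_sym : shifted_gram^T = shifted_gram.
Proof.
rewrite /shifted_gram linearD linearB /= linearZ /= trmx_mask tr_scalar_mx.
by rewrite trmx_mul trmxK.
Qed.

(** The coefficients of column t in its least squares fit by the columns in T; paired
    with the signs they give the value of the certificate at t. *)
Definition cert_vec (t : 'I_n) : 'cV[R]_n :=
  invmx shifted_gram *m ((B *m mask R T)^T *m col t B).

Lemma cert_vec_le t :
  (m / 2) ^+ 2 * fsq (cert_vec t) <= fsq ((B *m mask R T)^T *m col t B).
Proof.
by apply: le_trans (shifted_gram_lower _) _; rewrite mulKVmx // shifted_gram_unit.
Qed.

(** The least squares certificate w = B g with g = (A^T A)^-1 sgn x0.  Commutation of
    the shifted Gram matrix with the mask of T shows that g is supported on T. *)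
Lemma l1_recovery (x0 b : 'cV[R]_n) :
  (forall t, t \notin T -> x0 t 0 = 0) ->
  (forall t, t \notin T -> `|\sum_(s in T) Num.sg (x0 s 0) * cert_vec t s 0| < 1) ->
  B *m b = B *m x0 ->
  l1norm x0 <= l1norm b /\ (l1norm b <= l1norm x0 -> b = x0).
Proof.
move=> x0T cert; set M := shifted_gram.
have MT : M *m mask R T = A^T *m A.
  rewrite /M /shifted_gram mulmxDl mulmxBl -scalemxAl mask_idem mul_scalar_mx addrC.
  by rewrite subrK -/A /A trmx_mul trmx_mask -!mulmxA mask_idem.
have TM : mask R T *m M = A^T *m A.
  by rewrite -[LHS]trmxK trmx_mul trmx_mask shifted_gram_sym MT trmx_mul trmxK.
pose sig : 'cV[R]_n := mask R T *m (\col_s Num.sg (x0 s 0)).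
pose g := invmx M *m sig.
have Mg : M *m g = sig by rewrite mulKVmx // shifted_gram_unit.
have gT : mask R T *m g = g.
  have : M *m (mask R T *m g) = M *m g.
    by rewrite mulmxA MT -TM -mulmxA Mg /sig mulmxA mask_idem.
  by move/(congr1 (mulmx (invmx M))); rewrite !mulKmx // shifted_gram_unit.
apply: (@l1_certificate B x0 b (B *m g)) => //.
- move=> t tT; have -> : (B^T *m (B *m g)) t 0 = (mask R T *m (B^T *m (B *m g))) t 0.
    by rewrite mask_mulE tT mul1r.
  have -> : mask R T *m (B^T *m (B *m g)) = A^T *m A *m g.
    by rewrite -{1}gT /A trmx_mul trmx_mask !mulmxA.
  by rewrite -MT -mulmxA gT Mg /sig mask_mulE tT mul1r mxE.
- move=> t tT; have -> // : (B^T *m (B *m g)) t 0 =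
    \sum_(s in T) Num.sg (x0 s 0) * cert_vec t s 0; last exact: cert.
  have -> : (B^T *m (B *m g)) t 0 = ((cert_vec t)^T *m sig) 0 0.
    rewrite /cert_vec trmx_mul trmx_inv shifted_gram_sym -mulmxA -/g.
    rewrite trmx_mul trmxK -/A /A -!mulmxA gT !mxE.
    by apply: eq_bigr => k _; rewrite !mxE.
  rewrite mxE [RHS]big_mkcond; apply: eq_bigr => s _.
  rewrite /sig mask_mulE [in LHS]mxE [X in _ * (_ * X)]mxE.
  by case: (s \in T); [rewrite mul1r mulrC | rewrite mul0r mulr0].
- move=> x xT Bx.
  have Tx : mask R T *m x = x.
    apply/colP => t; rewrite mask_mulE; have [tT|tT] := boolP (t \in T).
      by rewrite mul1r.
    by rewrite mul0r xT.
  have : M *m x = 0 by rewrite -Tx mulmxA MT -mulmxA /A -!mulmxA Tx Bx !mulmx0.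
  by move/(congr1 (mulmx (invmx M))); rewrite mulKmx ?shifted_gram_unit // mulmx0.
Qed.
End Certificate.


(** * Correlations between distinct columns *)

Section Correlation.
Variables (R : realType) (n : nat) (Psi : 'M[R]_n.+1) (Om : {set 'I_n.+1}).
Notation N := n.+1.
Notation m := (#|Om|%:R : R).
Hypothesis orthoPsi : Psi^T *m Psi = 1%:M.
Variable q : R.
Hypothesis q0 : 0 <= q.
Hypothesis Psiq : forall t j : 'I_N, dft_sq (col t Psi) j <= q.

Lemma dft_sqZD (a : R) (x y : 'cV[R]_N) j : a ^+ 2 = 1 ->
  dft_sq (x + a *: y) j <= 2 * (dft_sq x j + dft_sq y j).
Proof.
move=> a1.
have re : dft_re (x + a *: y) j = dft_re x j + a * dft_re y j.
  rewrite /dft_re mulr_sumr -big_split; apply: eq_bigr => k _ /=.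
  by rewrite !mxE; ring.
have im : dft_im (x + a *: y) j = dft_im x j + a * dft_im y j.
  rewrite /dft_im mulr_sumr -big_split; apply: eq_bigr => k _ /=.
  by rewrite !mxE; ring.
have par (u v : R) : (u + a * v) ^+ 2 <= 2 * (u ^+ 2 + v ^+ 2).
  rewrite -subr_ge0; have -> : 2 * (u ^+ 2 + v ^+ 2) - (u + a * v) ^+ 2 =
    (u - a * v) ^+ 2 + 2 * (1 - a ^+ 2) * v ^+ 2 by ring.
  by rewrite a1 subrr mulr0 mul0r addr0 sqr_ge0.
rewrite /dft_sq re im; apply: le_trans (lerD (par _ _) (par _ _)) _; lra.
Qed.

Lemma hankelZ (a : R) (x : 'cV[R]_N) : hankel (a *: x) = a *: hankel x.
Proof. by apply/matrixP => i j; rewrite !mxE. Qed.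

Definition sensing_col (t : 'I_N) (e : {ffun 'I_N -> bool}) : 'cV[R]_N :=
  mask R Om *m (hankel (col t Psi) *m sign_vec R e).

(** By polarization, 4 <a_s, a_t> is the difference of two energies; their means
    cancel because the columns s and t of Psi are orthonormal. *)
Lemma correlation_moment (s t : 'I_N) (p : nat) : s != t ->
  48 * p.+1%:R * q <= m ->
  \sum_e \tr ((sensing_col s e)^T *m sensing_col t e) ^+ (2 * p.+1) <=
  6 * #|{ffun 'I_N -> bool}|%:R * (432 * (p.+1%:R * q * m)) ^+ p.+1.
Proof.
move=> st hm.
pose zz a e := fsq (mask R Om *m (hankel (col s Psi + a *: col t Psi) *m sign_vec R e)) - m * 2.
have fs (a : R) : a ^+ 2 = 1 -> fsq (col s Psi + a *: col t Psi) = 2.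
  move=> a1.
  have dotE i j : \tr ((col i Psi)^T *m col j Psi) = (i == j)%:R.
    have /matrixP /(_ i j) := orthoPsi; rewrite !mxE => <-.
    by rewrite /mxtrace big_ord1 mxE; apply: eq_bigr => k _; rewrite !mxE.
  rewrite fsqD fsqZ a1 /fsq -scalemxAr mxtraceZ !dotE !eqxx (negbTE st).
  by rewrite mulr1n mulr0n; ring.
(* Both signs a = 1 and a = -1 of the polarization identity are treated at once. *)
have mom (a : R) : a ^+ 2 = 1 -> \sum_e zz a e ^+ (2 * p.+1) <=
    3 * #|{ffun 'I_N -> bool}|%:R * (4 * (432 * (p.+1%:R * q * m))) ^+ p.+1.
  move=> a1; have := @conv_chaos_moment R n Om (col s Psi + a *: col t Psi) (4 * q) p.
  rewrite fs // => H.
  rewrite (_ : 4 * (432 * (p.+1%:R * q * m)) = 216 * p.+1%:R * (4 * q) * (m * 2)); last ring.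
  apply: H.
  - by rewrite mulr_ge0.
  - move=> j; apply: le_trans (dft_sqZD _ _ _ a1) _.
    by have := Psiq s j; have := Psiq t j; lra.
  - by move: hm; lra.
have pol e : 4 * \tr ((sensing_col s e)^T *m sensing_col t e) = zz 1 e - zz (-1) e.
  have spl a : mask R Om *m (hankel (col s Psi + a *: col t Psi) *m sign_vec R e) =
     sensing_col s e + a *: sensing_col t e.
    by rewrite hankelD hankelZ mulmxDl mulmxDr -scalemxAl -scalemxAr.
  rewrite /zz !spl scale1r scaleN1r !fsqD fsqN mulmxN raddfN /=; ring.
have b1 e : 4 ^+ p.+1 * \tr ((sensing_col s e)^T *m sensing_col t e) ^+ (2 * p.+1) <=
    zz 1 e ^+ (2 * p.+1) + zz (-1) e ^+ (2 * p.+1).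
  move: (pol e); set c := \tr _; set u := zz 1 e; set v := zz (-1) e => cE.
  have sq (y : R) : (2 * (2 * y ^+ 2)) ^+ p.+1 = 4 ^+ p.+1 * y ^+ (2 * p.+1).
    by rewrite exprM -exprMn; congr (_ ^+ _); ring.
  have le : (4 * c) ^+ 2 <= 2 * u ^+ 2 + 2 * v ^+ 2.
    by rewrite cE; have := sqr_ge0 (u + v); lra.
  have : ((4 * c) ^+ 2) ^+ p.+1 <= (2 * (2 * u ^+ 2)) ^+ p.+1 + (2 * (2 * v ^+ 2)) ^+ p.+1.
    have u0 := sqr_ge0 u; have v0 := sqr_ge0 v.
    apply: (@le_trans _ _ ((2 * u ^+ 2 + 2 * v ^+ 2) ^+ p.+1)).
      by apply: lerXn2r; rewrite ?nnegrE ?sqr_ge0 //; lra.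
    by apply: exprn_add2_le; lra.
  rewrite !sq -mulrDr (_ : ((4 * c) ^+ 2) ^+ p.+1 = 4 ^+ p.+1 * (4 ^+ p.+1 * c ^+ (2 * p.+1))).
    by rewrite ler_pM2l // exprn_gt0.
  by rewrite exprM -!exprMn; congr (_ ^+ _); ring.
have four : (0 : R) < 4 ^+ p.+1 by rewrite exprn_gt0.
rewrite -(ler_pM2l four) mulr_sumr.
apply: le_trans (ler_sum _ (fun e _ => b1 e)) _; rewrite big_split /=.
have m1 := mom 1 (expr1n _ _); have m2 := mom (-1) ltac:(by rewrite sqrrN expr1n).
apply: le_trans (lerD m1 m2) _; rewrite exprMn.
by rewrite le_eqVlt; apply/orP; left; apply/eqP; ring.
Qed.
End Correlation.

(** * Counting the bad sign patterns *)

Lemma ler_expr_inv (R : realFieldType) (k : nat) (x y : R) :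
  0 <= x -> 0 <= y -> x ^+ k.+1 <= y ^+ k.+1 -> x <= y.
Proof. by move=> x0 y0; rewrite ler_pXn2r. Qed.

Lemma natr_card_sum (R : realFieldType) (I : finType) (P : pred I) :
  #|[pred x | P x]|%:R = \sum_x (P x)%:R :> R.
Proof.
by rewrite -sum1_card natr_sum big_mkcond; apply: eq_bigr => x _; rewrite inE; case: (P x).
Qed.

Lemma sum_ord_const (R : realFieldType) (k : nat) (x : R) : \sum_(i < k) x = k%:R * x.
Proof. by rewrite sumr_const card_ord mulr_natl. Qed.

Lemma union_bound (R : realFieldType) (I : finType) (P : pred I) :
  (~~ [forall t, P t])%:R <= \sum_t (~~ P t)%:R :> R.
Proof.
have [_|/forallPn [t Pt]] /= := boolP [forall t, P t].
  by apply: sumr_ge0 => t _; rewrite ler0n.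
by rewrite (bigD1 t) //= Pt lerDl sumr_ge0.
Qed.

(** Markov's inequality for a moment bound f <= c b^k in the mean and a threshold a^k,
    where the ratio of b to a is at most y. *)
Lemma markov_frac (R : realFieldType) (E : finType) (f : E -> R) (k : nat) (a b c y : R) :
  (forall e, 0 <= f e) -> 0 < a -> 0 <= b -> 0 <= c -> 0 <= y -> b <= y * a ->
  \sum_e f e <= c * b ^+ k ->
  \sum_e (~~ (f e < a ^+ k))%:R <= c * y ^+ k.
Proof.
move=> f0 a0 b0 c0 y0 ba fle.
have ak : 0 < a ^+ k by rewrite exprn_gt0.
have := markov_count (a ^+ k) f0; rewrite natr_card_sum.
under eq_bigr do rewrite leNgt.
move=> le; rewrite -(ler_pM2r ak); apply: le_trans le _; apply: le_trans fle _.
rewrite -mulrA ler_wpM2l // -exprMn; apply: lerXn2r => //; rewrite nnegrE //.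
by rewrite mulr_ge0 // ltW.
Qed.

Lemma sum_subtype (R : realType) (n : nat) (T : {set 'I_n}) (F : 'I_n -> R) :
  \sum_(u : {t : 'I_n | t \in T}) F (val u) = \sum_(s in T) F s.
Proof.
rewrite [RHS](reindex_omap (val : {t : 'I_n | t \in T} -> 'I_n) insub) /=; last first.
  by move=> i iT; rewrite insubT.
by apply: eq_bigl => u; rewrite (valP u) valK eqxx.
Qed.

Section Counting.
Variables (R : realType) (n : nat) (Psi : 'M[R]_n.+1) (T Om : {set 'I_n.+1}).
Notation N := n.+1.
Notation cube := {ffun 'I_N -> bool}.
Notation zcube := {ffun {t : 'I_N | t \in T} -> bool}.
Notation m := (#|Om|%:R : R).
Notation S := (#|T|%:R : R).
Variables (q eta : R) (p : nat).
Notation P := (p.+1%:R : R).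
Hypothesis orthoPsi : Psi^T *m Psi = 1%:M.
Hypothesis q0 : 0 <= q.
Hypothesis Psiq : forall t j : 'I_N, dft_sq (col t Psi) j <= q.
Hypothesis eta01 : 0 < eta <= 1.
Hypothesis m0 : 0 < m.
Hypothesis S1 : 1 <= S.
Hypothesis hm : 6912 * (P ^+ 2 * S * q) <= eta ^+ 2 * m.

(** The threshold on squared correlations for which the vector v_t of least squares
    coefficients satisfies 4 p |v_t|^2 <= eta. *)
Definition corr_level : R := eta * m ^+ 2 / (16 * (P * S)).

Definition good_gram (e : cube) : bool :=
  \tr (gram_error Psi T Om e ^+ (2 * p.+1)) < ((m / 2) ^+ 2) ^+ p.+1.

Definition good_corr (e : cube) : bool :=
  [forall s, forall t, (s \in T) && (t \notin T) ==>
    (\tr ((sensing_col Psi Om s e)^T *m sensing_col Psi Om t e) ^+ (2 * p.+1)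
      < corr_level ^+ p.+1)].

Definition good_signs (e : cube) (z : zcube) : bool :=
  [forall t, (t \notin T) ==>
    ((\sum_u sign_of R z u * cert_vec T (sensing_mx Psi Om e) m t (val u) 0)
       ^+ (2 * p.+1) < 1 ^+ p.+1)].

Lemma col_sensing_mx e t : col t (sensing_mx Psi Om e) = sensing_col Psi Om t e.
Proof. by apply/colP => k; rewrite !mxE. Qed.

Lemma gram_error_sym e : (gram_error Psi T Om e)^T = gram_error Psi T Om e.
Proof. by rewrite gram_errorE // gram_chaos_sym. Qed.

Lemma order_ge1 : 1 <= P. Proof. by rewrite ler1n. Qed.

Let eta0 : 0 < eta. Proof. by case/andP: eta01. Qed.
Let eta1 : eta <= 1. Proof. by case/andP: eta01. Qed.
Let PS0 : 0 < P * S. Proof. by rewrite mulr_gt0 // (lt_le_trans _ S1). Qed.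
Let Pq0 : 0 <= P * q. Proof. by rewrite mulr_ge0. Qed.

Let hyp_eta : 6912 * (P ^+ 2 * S * q) <= eta * m.
Proof.
apply: le_trans hm _; rewrite expr2 -mulrA ler_piMl //.
by rewrite mulr_ge0 // ltW.
Qed.

Let hyp_one : 6912 * (P ^+ 2 * S * q) <= m.
Proof. by apply: le_trans hyp_eta _; rewrite ler_piMl // ltW. Qed.

Let PSq_le : P * S * q <= P ^+ 2 * S * q.
Proof.
rewrite expr2 -!mulrA -[leLHS]mul1r ler_wpM2r ?order_ge1 //.
by rewrite mulr_ge0 // mulr_ge0 // (le_trans ler01 S1).
Qed.

Let Pq_le : P * q <= P * S * q.
Proof. by rewrite -mulrA -[in leLHS](mul1r q) ler_wpM2l // ler_wpM2r. Qed.

Lemma corr_level_gt0 : 0 < corr_level.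
Proof. by rewrite /corr_level divr_gt0 ?mulr_gt0 // ?exprn_gt0 // (lt_le_trans _ S1). Qed.

Lemma gram_small e : good_gram e -> forall x : 'cV[R]_N,
  fsq (gram_error Psi T Om e *m x) <= (m / 2) ^+ 2 * fsq x.
Proof.
move=> ge x; have := fsq_mul_exp_le p x (gram_error_sym e).
have m20 : 0 <= (m / 2) ^+ 2 by apply: sqr_ge0.
move=> le; apply: (@ler_expr_inv _ p); first exact: fsq_ge0.
  by rewrite mulr_ge0 ?fsq_ge0.
rewrite exprMn; apply: le_trans le _; rewrite ler_wpM2r ?exprn_ge0 ?fsq_ge0 //; exact: ltW.
Qed.

Lemma bad_gram_count :
  \sum_(e : cube) (~~ good_gram e)%:R <=
  7 * N%:R ^+ 3 * #|{ffun 'I_N -> bool}|%:R * eta ^+ p.+1 :> R.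
Proof.
apply: (@markov_frac _ _ _ _ _ (288 * (P ^+ 2 * S * q * m))).
- by move=> e; rewrite trace_exp_even ?gram_error_sym // fsq_ge0.
- by rewrite exprn_gt0 // divr_gt0.
- apply: (mulr_ge0 (ler0n _ _)); apply: mulr_ge0 => //.
  by apply: le_trans PSq_le; rewrite -mulrA mulr_ge0 // mulr_ge0.
- by rewrite !mulr_ge0 // exprn_ge0.
- exact: ltW.
- rewrite expr_div_n; have := ler_wpM2r (ltW m0) hyp_eta.
  have := mulr_ge0 (ltW m0) (le_trans (mulr_ge0 (ltW PS0) q0) PSq_le).
  rewrite (_ : eta * (m ^+ 2 / 2 ^+ 2) = eta * m * m / 4); last by field.
  set w := P ^+ 2 * S * q; set v := eta * m * m; rewrite -[6912 * w * m]mulrA [m * w]mulrC; lra.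
- apply: gram_error_moment => //.
  have := mulr_ge0 (ltW PS0) q0; have := PSq_le; have := hyp_one; lra.
Qed.

Lemma bad_corr_count :
  \sum_(e : cube) (~~ good_corr e)%:R <=
  6 * N%:R ^+ 2 * #|{ffun 'I_N -> bool}|%:R * eta ^+ p.+1 :> R.
Proof.
pose bad s t e := ~~ ((s \in T) && (t \notin T) ==>
  (\tr ((sensing_col Psi Om s e)^T *m sensing_col Psi Om t e) ^+ (2 * p.+1)
      < corr_level ^+ p.+1)).
pose X : R := 6 * #|{ffun 'I_N -> bool}|%:R * eta ^+ p.+1.
have X0 : 0 <= X by rewrite !mulr_ge0 // exprn_ge0 // ltW.
have one s t : \sum_e (bad s t e)%:R <= X.
  have [/andP [sT tT]|ne] := boolP ((s \in T) && (t \notin T)); last first.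
    by rewrite big1 // => e _; rewrite /bad (negbTE ne).
  under eq_bigr do rewrite /bad sT tT /=.
  apply: (@markov_frac _ _ _ _ _ (432 * (P * q * m))).
  - by move=> e; rewrite exprM exprn_ge0 // sqr_ge0.
  - exact: corr_level_gt0.
  - by apply: (mulr_ge0 (ler0n _ _)); rewrite mulr_ge0.
  - by rewrite mulr_ge0.
  - exact: ltW.
  (* The constant 6912 is 432 * 16, from the moment and from the level. *)
  - rewrite /corr_level !mulrA ler_pdivlMr; last by rewrite -mulrA mulr_gt0.
    have := ler_wpM2r (ltW m0) hm.
    rewrite (_ : 432 * P * q * m * (16 * P * S) = 6912 * (P ^+ 2 * S * q) * m); last ring.
    by rewrite [eta ^+ 2]expr2.
  - apply: correlation_moment => //; first by apply: contraTneq sT => ->.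
    by have := Pq_le; have := PSq_le; have := hyp_one; have := Pq0; lra.
apply: (@le_trans _ _ (\sum_(e : cube) \sum_s \sum_t (bad s t e)%:R)).
  apply: ler_sum => e _; apply: le_trans (union_bound _ _) _.
  by apply: ler_sum => s _; apply: union_bound.
rewrite exchange_big /=.
have -> : 6 * N%:R ^+ 2 * #|{ffun 'I_N -> bool}|%:R * eta ^+ p.+1 = \sum_(s < N) \sum_(t < N) X.
  rewrite !sum_ord_const /X.
  by move: (N%:R : R) (#|_|%:R : R) (eta ^+ p.+1) => u v w; ring.
by apply: ler_sum => s _; rewrite exchange_big /=; apply: ler_sum => t _.
Qed.

(** For fixed filter signs the least squares coefficients are constants, so their
    pairing with the signs of x0 is a sign sum. *)
Lemma bad_signs_count e : good_gram e -> good_corr e ->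
  \sum_(z : zcube) (~~ good_signs e z)%:R <=
  N%:R * #|{ffun {t : 'I_N | t \in T} -> bool}|%:R * eta ^+ p.+1 :> R.
Proof.
move=> ge /forallP gc; set Bm := sensing_mx Psi Om e.
pose X : R := #|{ffun {t : 'I_N | t \in T} -> bool}|%:R * eta ^+ p.+1.
have X0 : 0 <= X by rewrite mulr_ge0 // exprn_ge0 // ltW.
have Zs : forall x : 'cV[R]_N, fsq (((Bm *m mask R T)^T *m (Bm *m mask R T) - m *: mask R T) *m x)
    <= (m / 2) ^+ 2 * fsq x by exact: gram_small.
have one t : \sum_(z : zcube) (~~ ((t \notin T) ==>
    ((\sum_u sign_of R z u * cert_vec T Bm m t (val u) 0) ^+ (2 * p.+1) < 1 ^+ p.+1)))%:R <= X.
  have [tT|tT] := boolP (t \in T); first by rewrite big1.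
  set v := cert_vec T Bm m t.
  have Sv : \sum_(u : {t : 'I_N | t \in T}) v (val u) 0 ^+ 2 <= fsq v.
    rewrite (sum_subtype _ (fun s => v s 0 ^+ 2)) fsq_cV [leRHS](bigID (mem T)) /= lerDl.
    by apply: sumr_ge0 => s _; apply: sqr_ge0.
  have cross : fsq ((Bm *m mask R T)^T *m col t Bm) <= S * corr_level.
    rewrite trmx_mul trmx_mask -mulmxA fsq_mask mulr_natl -sumr_const.
    apply: ler_sum => s sT; have /forallP /(_ t) := gc s; rewrite sT tT /= => lt.
    have -> : (Bm^T *m col t Bm) s 0 = \tr ((sensing_col Psi Om s e)^T *m sensing_col Psi Om t e).
      rewrite -!col_sensing_mx /mxtrace big_ord1 !mxE.
      by apply: eq_bigr => k _; rewrite !mxE.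
    apply: (@ler_expr_inv _ p); [exact: sqr_ge0|exact/ltW/corr_level_gt0|].
    by rewrite -exprM ltW.
  have vle : 4 * P * fsq v <= eta.
    have m20 : 0 < (m / 2) ^+ 2 by rewrite exprn_gt0 // divr_gt0.
    have := le_trans (cert_vec_le m0 Zs t) cross; rewrite -/v.
    rewrite -(ler_pM2l (mulr_gt0 (ltr0Sn R 3) (ltr0Sn R p))) -/v => le.
    rewrite -(ler_pM2l m20); apply: le_trans (_ : _ <= _) (le_trans le _).
      by rewrite le_eqVlt; apply/orP; left; apply/eqP; ring.
    rewrite le_eqVlt; apply/orP; left; apply/eqP; rewrite /corr_level.
    have Sn : S != 0 by rewrite gt_eqF // (lt_le_trans _ S1).
    have Pn : P != 0 by rewrite pnatr_eq0.
    by move: Pn Sn; move: P S => P' S' Pn Sn; field; rewrite Pn Sn.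
  rewrite /=.
  apply: (@markov_frac _ _ _ _ _ (4 * P * \sum_(u : {t : 'I_N | t \in T}) v (val u) 0 ^+ 2)) => //.
  - by move=> z; rewrite exprM exprn_ge0 // sqr_ge0.
  - by apply: mulr_ge0; [rewrite mulr_ge0|apply: sumr_ge0 => u _; apply: sqr_ge0].
  - exact: ltW.
  - by rewrite mulr1; apply: le_trans vle; rewrite ler_wpM2l // mulr_ge0.
  - exact: rademacher_moment.
have -> : N%:R * #|{ffun {t : 'I_N | t \in T} -> bool}|%:R * eta ^+ p.+1 = \sum_(t < N) X.
  rewrite sum_ord_const /X.
  by move: (N%:R : R) (#|_|%:R : R) (eta ^+ p.+1) => u v w; ring.
apply: (@le_trans _ _ (\sum_(z : zcube) \sum_t (~~ ((t \notin T) ==>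
    ((\sum_u sign_of R z u * cert_vec T Bm m t (val u) 0) ^+ (2 * p.+1) < 1 ^+ p.+1)))%:R)).
  by apply: ler_sum => z _; apply: union_bound.
by rewrite exchange_big /=; apply: ler_sum => t _.
Qed.

Definition good_pattern (x : cube * zcube) : bool :=
  [&& good_gram x.1, good_corr x.1 & good_signs x.1 x.2].

Lemma bad_count :
  #|[pred x | ~~ good_pattern x]|%:R <= 14 * N%:R ^+ 3 * eta ^+ p.+1 * #|{: cube * zcube}|%:R :> R.
Proof.
rewrite natr_card_sum -(pair_bigA _ (fun e z => (~~ good_pattern (e, z))%:R)) /= card_prod natrM.
set C : R := #|_|%:R; set Zc : R := #|_|%:R.
have Zc0 : 0 <= Zc by [].
pose Y : R := N%:R * Zc * eta ^+ p.+1.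
have E0 : 0 <= eta ^+ p.+1 by rewrite exprn_ge0 // ltW.
have Y0 : 0 <= Y by rewrite !mulr_ge0.
have one e : \sum_z (~~ good_pattern (e, z))%:R <=
    Zc * ((~~ good_gram e)%:R + (~~ good_corr e)%:R) + Y.
  have triv : \sum_z (~~ good_pattern (e, z))%:R <= Zc.
    rewrite /Zc -sum1_card natr_sum; apply: ler_sum => z _.
    by case: (good_pattern _).
  have [g1|g1] := boolP (good_gram e); last first.
    apply: le_trans triv _; rewrite mulrDr mulr1 -addrA lerDl addr_ge0 // mulr_ge0 //.
  have [g2|g2] := boolP (good_corr e); last first.
    by apply: le_trans triv _; rewrite add0r mulr1 lerDl.
  rewrite addr0 mulr0 add0r; under eq_bigr do rewrite /good_pattern /= g1 g2 /=.
  exact: bad_signs_count.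
apply: le_trans (ler_sum _ (fun e _ => one e)) _.
rewrite big_split /= sumr_const -mulr_sumr big_split /= -[Y *+ _]mulr_natl.
have C0 : 0 <= C by [].
have N1 : (1 : R) <= N%:R by rewrite ler1n.
have b1 := ler_wpM2l Zc0 bad_gram_count; have b2 := ler_wpM2l Zc0 bad_corr_count.
have CZE : 0 <= C * Zc * eta ^+ p.+1 by rewrite !mulr_ge0.
have N2 : N%:R ^+ 2 <= N%:R ^+ 3 :> R by rewrite ler_weXn2l.
have N3 : N%:R <= N%:R ^+ 3 :> R by rewrite -{1}[N%:R]expr1 ler_weXn2l.
have b3 := ler_wpM2r CZE N2; have b4 := ler_wpM2r CZE N3.
rewrite mulrDr /Y; move: b1 b2 b3 b4; rewrite -/C -/Zc; lra.
Qed.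

Lemma good_recovery e z (x0 b : 'cV[R]_N) : good_pattern (e, z) ->
  (forall t, t \notin T -> x0 t 0 = 0) ->
  (forall t : {t : 'I_N | t \in T}, Num.sg (x0 (val t) 0) = sign_of R z t) ->
  sensing_mx Psi Om e *m b = sensing_mx Psi Om e *m x0 ->
  l1norm x0 <= l1norm b /\ (l1norm b <= l1norm x0 -> b = x0).
Proof.
move=> /and3P [/= g1 g2 /forallP g3] x0T x0z Bb.
apply: (@l1_recovery R N T (sensing_mx Psi Om e) m m0 (gram_small g1)) => // t tT.
have := g3 t; rewrite tT /= => lt.
have : (\sum_(s in T) Num.sg (x0 s 0) * cert_vec T (sensing_mx Psi Om e) m t s 0) ^+ 2 < 1.
  rewrite -(@ltr_pXn2r _ p.+1) ?nnegrE ?sqr_ge0 // -exprM.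
  rewrite -(sum_subtype _ (fun s => Num.sg (x0 s 0) * cert_vec T (sensing_mx Psi Om e) m t s 0)).
  by under eq_bigr do rewrite x0z.
by rewrite -real_normK ?num_real // expr_lt1.
Qed.
End Counting.

(** * From counting sign patterns to probabilities *)

Section Probability.
Context (R : realType) (d : measure_display) (W : measurableType d).
Context (P : probability W R).

Definition sign_event (I : finType) (X : I -> {RV P >-> R}) (e : {ffun I -> bool}) : set W :=
  \bigcap_(i in [set: I]) (X i @^-1` [set sign_of R e i]).

Lemma sign_event_generated (I : finType) (X : I -> {RV P >-> R}) e :
  sigma_generated X (sign_event X e).
Proof.
pose G := [set A | exists i : I, exists2 B : set R, measurable B & A = X i @^-1` B].
change (@measurable _ (g_sigma_algebraType G) (sign_event X e)).
apply: fin_bigcap_measurable => [|i _]; first exact: finite_finset.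
by apply: sub_sigma_algebra; exists i, [set sign_of R e i].
Qed.

Lemma sign_event_measurable (I : finType) (X : I -> {RV P >-> R}) e :
  measurable (sign_event X e).
Proof.
apply: fin_bigcap_measurable => [|i _]; first exact: finite_finset.
exact: measurable_funPTI.
Qed.

Lemma prob_sign_event (I : finType) (X : I -> {RV P >-> R}) e :
  (forall i, rademacher (X i)) -> independent_family X ->
  P (sign_event X e) = ((2 ^+ #|I|)^-1)%:E.
Proof.
move=> rad ind.
have := ind [set: I]%SET (fun i => [set sign_of R e i]) (fun i => @measurable_set1 R _).
have -> : [set i | i \in [set: I]%SET] = [set: I].
  by apply/seteqP; split => x //= _; rewrite inE.
rewrite -/(sign_event X e) => ->.
have E i : P (X i @^-1` [set sign_of R e i]) = (2^-1)%:E.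
  have [h1 h2] := rad i; rewrite /sign_of.
  by case: (e i); rewrite ?expr1 ?expr0 (h1, h2) div1r.
under eq_bigr do rewrite E.
rewrite prodEFin prodr_const cardsT exprVn //.
Qed.

Lemma sign_event_disjoint (I : finType) (X : I -> {RV P >-> R}) (e e' : {ffun I -> bool}) w :
  sign_event X e w -> sign_event X e' w -> e = e'.
Proof.
move=> H H'; apply/ffunP => i; have := H i Logic.I; rewrite /= (H' i Logic.I) /sign_of.
case: (e i); case: (e' i) => //; rewrite expr0 expr1 => h.
  by have h' : (1 : R) = -1 := h; exfalso; lra.
by have h' : (-1 : R) = 1 := h; exfalso; lra.
Qed.

(** Under the hypotheses every sign pattern has the same probability, so a property
    of patterns has the probability of its proportion among them. *)
Lemma sign_event_prob (I J : finType) (X : I -> {RV P >-> R}) (Y : J -> {RV P >-> R})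
    (good : pred ({ffun I -> bool} * {ffun J -> bool})) (delta : R) :
  (forall i, rademacher (X i)) -> independent_family X -> uniform_signs Y ->
  independent_of X Y ->
  #|[pred x | ~~ good x]|%:R < delta * (2 ^+ #|I| * 2 ^+ #|J|) ->
  exists E : set W, [/\ measurable E, ((1 - delta)%:E < P E)%E &
    forall w, E w -> exists x, [/\ good x, forall i, X i w = sign_of R x.1 i &
      forall j, Y j w = sign_of R x.2 j]].
Proof.
move=> rad indX unif indXY small.
pose ev (x : {ffun I -> bool} * {ffun J -> bool}) := sign_event X x.1 `&` sign_event Y x.2.
have mev x : measurable (ev x) by apply: measurableI; exact: sign_event_measurable.
pose c : R := (2 ^+ #|I| * 2 ^+ #|J|)^-1.
have Pev x : P (ev x) = c%:E.
  have mul : P (ev x) = (P (sign_event X x.1) * P (sign_event Y x.2))%E.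
    by apply: indXY; exact: sign_event_generated.
  rewrite mul.
  rewrite prob_sign_event //.
  by rewrite [X in (_ * X)%E](unif (fun j => x.2 j)) -EFinM /c invfM.
have total : #|{: {ffun I -> bool} * {ffun J -> bool}}|%:R * c = 1.
  by rewrite card_prod !card_ffun card_bool natrM !natrX /c divff.
exists (\bigcup_(x in [set x | good x]) ev x); split.
- by apply: fin_bigcup_measurable => //; exact: finite_finset.
- rewrite measure_fin_bigcup //; [|exact: finite_finset|]; last first.
    move=> x y _ _ [w [[/= h1 h2] [h3 h4]]].
    rewrite [x]surjective_pairing [y]surjective_pairing.
    by rewrite (sign_event_disjoint h1 h3) (sign_event_disjoint h2 h4).
  have -> : [set x | good x] = [set` enum good].
    by apply/seteqP; split => x /=; rewrite mem_enum.
  rewrite -fsbig_seq ?enum_uniq //.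
  rewrite (eq_bigr (fun=> c%:E)) => [|x _]; last exact: Pev.
  rewrite sumEFin lte_fin big_enum /= sumr_const -mulr_natl.
  have c0 : 0 < c by rewrite invr_gt0 mulr_gt0 ?exprn_gt0.
  have split_card : #|good|%:R = #|{: {ffun I -> bool} * {ffun J -> bool}}|%:R
      - #|[pred x | ~~ good x]|%:R :> R.
    by rewrite -(cardC good) natrD addrK.
  rewrite split_card mulrBl total; rewrite ltrD2l ltrN2.
  by rewrite /c ltr_pdivrMr // mulr_gt0 // exprn_gt0.
- move=> w [x gx [h1 h2]]; exists x; split=> // i; [exact: (h1 i Logic.I)|exact: (h2 i Logic.I)].
Qed.
End Probability.


(** * Recovery from random convolutions *)

Section Assembly.
Variables (R : realType) (n : nat) (Psi : 'M[R]_n.+1).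
Notation N := n.+1.

(** Substituting j = i + k in the product of the circulant matrix with Psi. *)
Lemma sensing_mxE (Om : {set 'I_N}) (e : {ffun 'I_N -> bool}) :
  sensing_mx Psi Om e = mask R Om *m (circulant_mx (\row_i sign_of R e i) *m Psi).
Proof.
apply/matrixP => k t; rewrite mxE mask_mulE /mask mul_diag_mx [in RHS]mxE [in RHS]mxE.
congr (_ * _); rewrite !mxE (reindex_inj (@addrI _ (- k))) /=.
apply: eq_bigr => j _; rewrite circulantE !mxE addrA subrr add0r addrC.
by rewrite mulrC.
Qed.

Lemma mask_submx_rows (Om : {set 'I_N}) (U : 'M[R]_N) (b c : 'cV[R]_N) :
  submx_rows Om U *m b = submx_rows Om U *m c ->
  mask R Om *m U *m b = mask R Om *m U *m c.
Proof.
move=> H; apply/colP => k; rewrite -!mulmxA !mask_mulE.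
have [kOm|] := boolP (k \in Om); last by rewrite !mul0r.
rewrite !mul1r; have /colP /(_ (enum_rank_in kOm k)) := H.
by rewrite !mxE; under eq_bigr do rewrite mxE enum_rankK_in //;
   under [X in _ = X -> _]eq_bigr do rewrite mxE enum_rankK_in //.
Qed.

Lemma unique_l1_of_recovery (Om : {set 'I_N}) (U : 'M[R]_N) (x0 : 'cV[R]_N) :
  (forall b, mask R Om *m U *m b = mask R Om *m U *m x0 ->
     l1norm x0 <= l1norm b /\ (l1norm b <= l1norm x0 -> b = x0)) ->
  unique_l1_minimizer (submx_rows Om U) (submx_rows Om U *m x0) x0.
Proof.
move=> H; split; first by split=> // b /mask_submx_rows /H [].
by move=> b [Ub bmin]; have [_] := H b (mask_submx_rows Ub); apply; apply: bmin.
Qed.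
End Assembly.

(** The sampled matrix has a single entry, which is a sign times plus or minus one. *)
Lemma recovery_dim1 (R : realType) (Om : {set 'I_1}) : 0 < #|Om|%:R :> R ->
  forall Psi : 'M[R]_1, orthogonal_mx Psi -> forall (b x0 : 'cV[R]_1) e,
  sensing_mx Psi Om e *m b = sensing_mx Psi Om e *m x0 -> b = x0.
Proof.
rewrite ltr0n => /card_gt0P [i iOm] Psi ortho b x0 e.
have Psi0 : Psi 0 0 != 0.
  apply/eqP => P0; have /matrixP /(_ 0 0) := ortho.
  by rewrite !mxE big_ord1 P0 mulr0 eqxx => /eqP; rewrite eq_sym oner_eq0.
have s0 : sensing_mx Psi Om e 0 0 != 0.
  rewrite mxE mask_mulE -(ord1 i) iOm mul1r ord1 mxE big_ord1 !mxE mulf_neq0 ?signr_eq0 //.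
  by rewrite [(0 + 0)%R]ord1.
move=> /colP /(_ 0); rewrite mxE big_ord1 [in RHS]mxE big_ord1 => /(mulfI s0) b0.
by apply/colP => j; rewrite ord1.
Qed.

(** From 1 - 1/2 <= e^(-1/2). *)
Lemma ln_ge_half (R : realType) (x : R) : 2 <= x -> 2^-1 <= ln x.
Proof.
move=> x2; have x0 : 0 < x by apply: lt_le_trans x2.
have := expR_ge1Dx (- 2^-1 : R); rewrite expRN => le.
rewrite -ler_expR lnK ?posrE //; apply: le_trans x2.
rewrite -[leLHS]invrK -[leRHS]invrK lef_pV2 ?posrE ?invr_gt0 ?expR_gt0 //.
by apply: le_trans le; lra.
Qed.

Lemma powR_three_half (R : realType) (x : R) : 2^-1 <= x -> x / 2 <= x `^ (3 / 2).
Proof.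
move=> xh; have x0 : 0 < x by apply: lt_le_trans xh.
have -> : (3 / 2 : R) = 1 + 2^-1 by lra.
rewrite powRD; last by apply/implyP => _; rewrite gt_eqF.
rewrite (powRr1 (ltW x0)) (ler_pM2l x0) powR12_sqrt ?(ltW x0) //.
apply: (@ler_expr_inv _ 1); rewrite ?sqrtr_ge0 ?invr_ge0 // sqr_sqrtr ?(ltW x0) //.
by rewrite expr2; lra.
Qed.

(** With r = delta / n the bound is 14 delta^3 r^5, and r <= 1/2. *)
Lemma failure_small (R : realType) (N : nat) (delta : R) (p : nat) :
  (2 <= N)%N -> 0 < delta < 1 -> ln (N%:R / delta) < p.+1%:R ->
  14 * N%:R ^+ 3 * expR (- 8) ^+ p.+1 < delta.
Proof.
move=> N2 /andP [d0 d1] Lp; have N0 : (0 : R) < N%:R by rewrite ltr0n (ltn_trans _ N2).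
pose r : R := delta / N%:R.
have r0 : 0 < r by rewrite divr_gt0.
have rN : N%:R * r = delta by rewrite /r mulrCA divff ?mulr1 // gt_eqF.
have rh : r <= 2^-1.
  rewrite /r ler_pdivrMr //; apply: le_trans (ltW d1) _.
  by rewrite mulrC ler_pdivlMr // mul1r ler_nat.
have e8 : expR (- 8) ^+ p.+1 <= r ^+ 8.
  rewrite -expRM_natr (_ : -8 * p.+1%:R = - p.+1%:R * 8%:R); last by ring.
  rewrite expRM_natr; apply: lerXn2r; rewrite ?nnegrE ?expR_ge0 ?(ltW r0) //.
  rewrite expRN -[leRHS]invrK lef_pV2 ?posrE ?expR_gt0 ?invr_gt0 //.
  rewrite /r invf_div -ler_ln ?posrE ?expR_gt0 ?divr_gt0 // expRK.
  exact: ltW.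
apply: (@le_lt_trans _ _ (14 * N%:R ^+ 3 * r ^+ 8)).
  by rewrite ler_wpM2l // mulr_ge0 // exprn_ge0 // ltW.
have -> : 14 * N%:R ^+ 3 * r ^+ 8 = 14 * (N%:R * r) ^+ 3 * r ^+ 5 by ring.
rewrite rN; have r5 : r ^+ 5 <= 2^-1 ^+ 5.
  by apply: lerXn2r; rewrite ?nnegrE ?invr_ge0 // ltW.
have d3 : delta ^+ 3 <= delta by apply: ler_iXnr => //; rewrite ltW.
apply: (@le_lt_trans _ _ (14 * delta * 2^-1 ^+ 5)).
  apply: ler_pM => //; first by rewrite mulr_ge0 // exprn_ge0 // ltW.
  - by rewrite exprn_ge0 // ltW.
  - by rewrite ler_wpM2l.
have -> : (2^-1 : R) ^+ 5 = 32^-1 by field.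
lra.
Qed.

(** Here L^(3/2) >= L/2 and P <= L + 1 <= 3 L. *)
Lemma level_bound (R : realType) (K eta L s m P : R) : 0 < eta -> 0 <= s ->
  K = 18 * 6912 / eta ^+ 2 -> 2^-1 <= L -> P <= L + 1 -> 0 <= P ->
  K * s * L `^ (3 / 2) * L < m -> 6912 * (P ^+ 2 * s) <= eta ^+ 2 * m.
Proof.
move=> eta0 s0 KE Lh PL P0 hyp; have E0 : 0 < eta ^+ 2 by rewrite exprn_gt0.
have L0 : 0 < L by apply: lt_le_trans Lh.
have pw := powR_three_half Lh.
have P3 : P ^+ 2 <= 9 * L ^+ 2.
  have -> : 9 * L ^+ 2 = (3 * L) ^+ 2 by ring.
  apply: lerXn2r; rewrite ?nnegrE //; last by lra.
  by rewrite mulr_ge0 // ltW.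
have Em : 18 * 6912 * s * L `^ (3 / 2) * L <= eta ^+ 2 * m.
  apply: le_trans (ler_wpM2l (ltW E0) (ltW hyp)); rewrite KE.
  rewrite le_eqVlt; apply/orP; left; apply/eqP.
  by move: (L `^ (3 / 2)) => y; field; rewrite gt_eqF.
apply: le_trans Em.
have sL0 : 0 <= s * L by rewrite mulr_ge0 // ltW.
have := ler_wpM2l sL0 pw; have := ler_wpM2l s0 P3.
move: (L `^ (3 / 2)) => y; lra.
Qed.

Theorem theorem1p2 (R : realType) :
  exists2 K : R, 0 < K &
  forall (n : nat) (Psi : 'M[R]_n) (T : {set 'I_n}) (S : nat)
    (d : measure_display) (W : measurableType d) (P : probability W R)
    (h : 'I_n -> {RV P >-> R}) (z : {t : 'I_n | t \in T} -> {RV P >-> R})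
    (Omega : {set 'I_n}) (m : nat) (delta : R),
  (1 <= n)%N ->
  orthogonal_mx Psi ->
  (forall i : 'I_n, rademacher (h i)) ->
  independent_family h ->
  #|T| = S -> (1 <= S)%N ->
  uniform_signs z ->
  independent_of h z ->
  #|Omega| = m ->
  0 < delta < 1 ->
  K * S%:R * coherence (dft_mx R n) Psi ^+ 2 * ln (n%:R / delta) `^ (3 / 2)
    * Num.max (ln (4 * expR 2 * (S%:R + 1) ^+ 2)) (ln (n%:R / delta)) < m%:R ->
  exists E : set W,
    [/\ measurable E, ((1 - delta)%:E < P E)%E &
        forall w : W, E w ->
          let U := circulant_mx (\row_(i < n) h i w) *m Psi in
          forall x0 : 'cV[R]_n,
            supported_with_signs (fun t => z t w) x0 ->
            unique_l1_minimizer (submx_rows Omega U)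
              (submx_rows Omega U *m x0) x0].
Proof.
(* The exponent 8 beats the factor n^3 of the union bounds and leaves a power of delta. *)
pose eta : R := expR (- 8).
have eta0 : 0 < eta by apply: expR_gt0.
have eta1 : eta <= 1 by rewrite -[leRHS]expR0 ler_expR; lra.
(* The factor 18 pays for P^2 <= 9 L^2 and for L^(3/2) >= L/2 in level_bound. *)
have [K K0 KE] : exists2 K : R, 0 < K & K = 18 * 6912 / eta ^+ 2.
  by eexists; last reflexivity; apply: divr_gt0; [lra|exact: exprn_gt0].
exists K => // -[//|n] Psi T _ d W P h z Om _ delta _ ortho rad indh <- S1 unif indhz <- dl hyp.
have /andP [d0 d1] := dl.
set N := n.+1 in hyp; set q := coherence _ _ ^+ 2 in hyp.
set L := ln _ in hyp.
have q0 : 0 <= q by apply: sqr_ge0.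
have Nd : 1 < N%:R / delta.
  by rewrite ltr_pdivlMr // mul1r (lt_le_trans d1) // ler1n.
have L0 : 0 < L by apply: ln_gt0.
have S0 : (1 : R) <= #|T|%:R by rewrite ler1n.
have pos : 0 <= K * #|T|%:R * q * L `^ (3 / 2).
  apply: mulr_ge0 (powR_ge0 _ _); apply: mulr_ge0 q0.
  exact: mulr_ge0 (ltW K0) (ler0n _ _).
have hyp' : K * #|T|%:R * q * L `^ (3 / 2) * L < #|Om|%:R.
  by apply: le_lt_trans hyp; rewrite ler_wpM2l // le_max lexx orbT.
have m0 : (0 : R) < #|Om|%:R.
  by apply: le_lt_trans hyp'; apply: mulr_ge0 => //; exact: ltW.
pose g : pred ({ffun 'I_N -> bool} * {ffun {t : 'I_N | t \in T} -> bool}) :=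
  (* The dimension is n.+1, so n = 0 is the case of dimension 1. *)
  if (n == 0)%N then xpredT else good_pattern Psi Om eta (Num.truncn L).
have gbad : #|[pred x | ~~ g x]|%:R <
    delta * (2 ^+ #|'I_N| * 2 ^+ #|{: {t : 'I_N | t \in T}}|).
  rewrite /g; case: (n =P 0%N) => [n0|/eqP n0].
    by rewrite eq_card0 // mulr_gt0 // mulr_gt0 // exprn_gt0.
  have N2 : (2 <= N)%N by rewrite ltnS lt0n.
  have Lh : 2^-1 <= L.
    apply: ln_ge_half; rewrite ler_pdivlMr //.
    apply: le_trans (_ : 2 <= _); last by rewrite ler_nat.
    by rewrite -[leRHS]mulr1 ler_wpM2l // ltW.
  have Lp := truncnS_gt L.
  have Psiq t (j : 'I_N) : dft_sq (col t Psi) j <= q by apply: dft_sq_le_coherence.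
  have lev : 6912 * ((Num.truncn L).+1%:R ^+ 2 * #|T|%:R * q) <= eta ^+ 2 * #|Om|%:R.
    rewrite -[_ * _ * q]mulrA; apply: (@level_bound _ K _ L) => //.
    - by rewrite mulr_ge0.
    - by rewrite -natr1 lerD2r truncn_le ltW.
    - by rewrite [K * _]mulrA.
  apply: le_lt_trans (bad_count ortho q0 Psiq _ m0 S0 lev) _.
    by rewrite eta0.
  rewrite card_prod !card_ffun card_bool natrM !natrX ltr_pM2r; first exact: failure_small.
  by rewrite mulr_gt0 // exprn_gt0.
have [E [mE PE HE]] := sign_event_prob rad indh unif indhz gbad.
exists E; split=> // w /HE [[e s] [ges hw zw]] U x0 [x0T x0z].
have UE : U = circulant_mx (\row_i sign_of R e i) *m Psi.
  by rewrite /U; congr (circulant_mx _ *m _); apply/rowP => i; rewrite !mxE hw.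
apply: unique_l1_of_recovery => b; rewrite UE -sensing_mxE => Ub.
have [n0|n0] := eqVneq n 0%N; last first.
  move: ges; rewrite /g (negbTE n0) => ges.
  apply: (good_recovery ortho m0 ges x0T _ Ub) => t.
  by rewrite x0z zw.
have -> : b = x0; last by split.
(* All objects that depend on the dimension are generalized before n is replaced. *)
move: (Om) (m0) (Psi) (ortho) (b) (x0) (e) Ub; rewrite n0; exact: recovery_dim1.
Qed.
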